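(* Let $T$ be a centralizable Hopf monad on an autonomous category $\mathcal{C}$, with product $\mu$, left antipode $s^l$, and centralizer $(Z_T,\partial)$. Set $i_{X,Y}=(\mathrm{ev}_{T(Y)}\otimes\mathrm{id}_{Z_T(X)})(\mathrm{id}_{{}^\vee T(Y)}\otimes\partial_{X,Y})\colon {}^\vee T(Y)\otimes X\otimes Y\to Z_T(X)$, and let $\Omega\colon TZ_T\to Z_TT$ be the natural transformation defined by $$\Omega_X\,T(i_{X,Y})=i_{T(X),T(Y)}\bigl({}^\vee\mu_Y\,s^l_{T(Y)}\,T({}^\vee\mu_Y)\otimes\mathrm{id}_{T(X)\otimes T(Y)}\bigr)\,T_3({}^\vee T(Y),X,Y)$$ for all objects $X,Y$ of $\mathcal{C}$. Then $\Omega$ is an invertible comonoidal distributive law of $T$ over $Z_T$.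
   Context: Categories are small and monoidal categories are strict, with product $\otimes$ and unit $\mathbf 1$. A monoidal category is autonomous if every object $X$ has a left dual ${}^\vee X$ (with $\mathrm{ev}_X\colon {}^\vee X\otimes X\to\mathbf 1$, $\mathrm{coev}_X\colon \mathbf 1\to X\otimes {}^\vee X$) and a right dual $X^\vee$ (with $\widetilde{\mathrm{ev}}_X\colon X\otimes X^\vee\to \mathbf 1$, $\widetilde{\mathrm{coev}}_X\colon \mathbf 1\to X^\vee\otimes X$). Duals are chosen; ${}^\vee f$, $f^\vee$ are dual morphisms; ${}^\vee T(X)$ means ${}^\vee(T(X))$. A comonoidal functor $F$ is a functor with a natural transformation $F_2(X,Y)\colon F(X\otimes Y)\to F(X)\otimes F(Y)$ and a morphism $F_0\colon F(\mathbf 1)\to \mathbf 1$ that are coassociative and counital; $F_3(X,Y,Z)=(\mathrm{id}\otimes F_2(Y,Z))F_2(X,Y\otimes Z)$. A natural transformation $\varphi\colon F\to G$ is comonoidal if $G_2(X,Y)\varphi_{X\otimes Y}=(\varphi_X\otimes\varphi_Y)F_2(X,Y)$ and $G_0\varphi_{\mathbf 1}=F_0$. Composites are comonoidal by $(GF)_2(X,Y)=G_2(F(X),F(Y))G(F_2(X,Y))$, $(GF)_0=G_0G(F_0)$. A bimonad is a monad $(T,\mu,\eta)$ with a comonoidal structure on $T$ such that $\mu,\eta$ are comonoidal. A left antipode for $T$ is a natural transformation $s^l_X\colon T({}^\vee T(X))\to {}^\vee X$ with $T_0T(\mathrm{ev}_X)T({}^\vee\eta_X\otimes \mathrm{id}_X)=\mathrm{ev}_{T(X)}(s^l_{T(X)}T({}^\vee\mu_X)\otimes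 \mathrm{id})T_2({}^\vee T(X),X)$ and $(\eta_X\otimes \mathrm{id}_{{}^\vee X})\mathrm{coev}_XT_0=(\mu_X\otimes s^l_X)T_2(T(X),{}^\vee T(X))T(\mathrm{coev}_{T(X)})$. A right antipode is a natural transformation $s^r_X\colon T(T(X)^\vee)\to X^\vee$ with $T_0T(\widetilde{\mathrm{ev}}_X)T(\mathrm{id}_X\otimes\eta_X^\vee)=\widetilde{\mathrm{ev}}_{T(X)}(\mathrm{id}\otimes s^r_{T(X)}T(\mu_X^\vee))T_2(X,T(X)^\vee)$ and $(\mathrm{id}_{X^\vee}\otimes\eta_X)\widetilde{\mathrm{coev}}_XT_0=(s^r_X\otimes\mu_X)T_2(T(X)^\vee,T(X))T(\widetilde{\mathrm{coev}}_{T(X)})$. A Hopf monad is a bimonad on an autonomous category having a left and a right antipode. A centralizer of an endofunctor $T$ is a pair $(Z_T,\partial)$ with $Z_T$ an endofunctor and $\partial_{X,Y}\colon X\otimes Y\to T(Y)\otimes Z_T(X)$ natural in $X,Y$, such that for all objects $X,W$ and every natural $\{\xi_Y\colon X\otimes Y\to T(Y)\otimes W\}_Y$ there is a unique $r\colon Z_T(X)\to W$ with $\xi_Y=(\mathrm{id}_{T(Y)}\otimes r)\partial_{X,Y}$ for all $Y$. $T$ is centralizable if it has a centralizer. Then $i_{X,-}$ is a universal dinatural transformation making $Z_T(X)$ the coend $\int^{Y\in\mathcal{C}}{}^\vee T(Y)\otimes X\otimes Y$; since a Hopf monad preserves colimits, $T(i_{X,-})$ is also universal, so the displayed formula defines $\Omega$.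 For $T$ a Hopf monad, $Z_T$ carries the Hopf monad structure with product $m$, unit $u$ and comonoidal structure determined by $(\mathrm{id}\otimes m_X)(\mathrm{id}_{T(Y_1)}\otimes\partial_{Z_T(X),Y_2})(\partial_{X,Y_1}\otimes\mathrm{id}_{Y_2})=(T_2(Y_1,Y_2)\otimes\mathrm{id}_{Z_T(X)})\partial_{X,Y_1\otimes Y_2}$, $u_X=(T_0\otimes\mathrm{id}_{Z_T(X)})\partial_{X,\mathbf 1}$, $(\mathrm{id}_{T(Y)}\otimes(Z_T)_2(X_1,X_2))\partial_{X_1\otimes X_2,Y}=(\mu_Y\otimes\mathrm{id})(\partial_{X_1,T(Y)}\otimes\mathrm{id}_{Z_T(X_2)})(\mathrm{id}_{X_1}\otimes\partial_{X_2,Y})$, $(\mathrm{id}_{T(Y)}\otimes(Z_T)_0)\partial_{\mathbf 1,Y}=\eta_Y$. A distributive law of a monad $(T,\mu,\eta)$ over a monad $(P,m,u)$ is a natural transformation $\Omega\colon TP\to PT$ with $\Omega_XT(m_X)=m_{T(X)}P(\Omega_X)\Omega_{P(X)}$, $\Omega_XT(u_X)=u_{T(X)}$, $\Omega_X\mu_{P(X)}=P(\mu_X)\Omega_{T(X)}T(\Omega_X)$, $\Omega_X\eta_{P(X)}=P(\eta_X)$. For bimonads it is comonoidal if it is a comonoidal natural transformation. *)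

(* Defs.v *)
Set Implicit Arguments.
Unset Strict Implicit.
Unset Printing Implicit Defensive.

(** * Categories, functors, natural transformations *)

Record category := Category {
  obj :> Type;
  hom : obj -> obj -> Type;
  id : forall X, hom X X;
  comp : forall X Y Z, hom Y Z -> hom X Y -> hom X Z;
  comp_idl : forall X Y (f : hom X Y), comp (id Y) f = f;
  comp_idr : forall X Y (f : hom X Y), comp f (id X) = f;
  comp_assoc : forall W X Y Z (h : hom Y Z) (g : hom X Y) (f : hom W X),
    comp h (comp g f) = comp (comp h g) f
}.

Arguments hom {c} X Y.
Arguments id {c} X.
Arguments comp {c X Y Z} g f : rename.

Notation "g ∘ f" := (comp g f) (at level 40, left associativity).

(* The identity of [X], seen as a morphism to an object equal to [X]. *)
Definition id_of_eq (C : category) (X Y : C) (e : X = Y) : hom X Y :=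
  match e in _ = Y' return hom X Y' with eq_refl => id X end.

Record functor (C D : category) := Functor {
  fobj :> C -> D;
  fmap : forall X Y : C, hom X Y -> hom (fobj X) (fobj Y);
  fmap_id : forall X : C, fmap (id X) = id (fobj X);
  fmap_comp : forall (X Y Z : C) (g : hom Y Z) (f : hom X Y),
    fmap (g ∘ f) = fmap g ∘ fmap f
}.

Arguments fmap {C D} F {X Y} f : rename.

Definition id_functor (C : category) : functor C C :=
  @Functor C C (fun X => X) (fun _ _ f => f)
    (fun _ => eq_refl) (fun _ _ _ _ _ => eq_refl).

Definition comp_functor (C D E : category) (G : functor D E) (F : functor C D) :
  functor C E.
Proof.
refine (@Functor C E (fun X => G (F X)) (fun _ _ f => fmap G (fmap F f)) _ _).
- intro X; rewrite !fmap_id; reflexivity.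
- intros X Y Z g f; rewrite !fmap_comp; reflexivity.
Defined.

Record nat_trans (C D : category) (F G : functor C D) := NatTrans {
  component :> forall X : C, hom (F X) (G X);
  naturality : forall (X Y : C) (f : hom X Y),
    component Y ∘ fmap F f = fmap G f ∘ component X
}.

Definition invertible (C D : category) (F G : functor C D)
    (phi : nat_trans F G) : Prop :=
  exists psi : nat_trans G F,
    (forall X, psi X ∘ phi X = id (F X)) /\
    (forall X, phi X ∘ psi X = id (G X)).

(** * Strict monoidal categories *)

(* Strictness is an equality of objects, so a morphism equation whose two sides
   have propositionally equal domains or codomains is stated through the
   identities [id_of_eq]. *)
Record monoidal_category := MonoidalCategory {
  mcat :> category;
  unit : mcat;
  tens : mcat -> mcat -> mcat;
  tensm : forall X Y X' Y' : mcat,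
    hom X X' -> hom Y Y' -> hom (tens X Y) (tens X' Y');
  tensm_id : forall X Y : mcat, tensm (id X) (id Y) = id (tens X Y);
  tensm_comp : forall (X Y X' Y' X'' Y'' : mcat)
      (f' : hom X' X'') (f : hom X X') (g' : hom Y' Y'') (g : hom Y Y'),
    tensm (f' ∘ f) (g' ∘ g) = tensm f' g' ∘ tensm f g;
  tensA : forall X Y Z : mcat, tens (tens X Y) Z = tens X (tens Y Z);
  tens1o : forall X : mcat, tens unit X = X;
  tenso1 : forall X : mcat, tens X unit = X;
  tensmA : forall (X Y Z X' Y' Z' : mcat)
      (f : hom X X') (g : hom Y Y') (h : hom Z Z'),
    id_of_eq (tensA X' Y' Z') ∘ tensm (tensm f g) h =
    tensm f (tensm g h) ∘ id_of_eq (tensA X Y Z);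
  tensm1o : forall (X Y : mcat) (f : hom X Y),
    id_of_eq (tens1o Y) ∘ tensm (id unit) f = f ∘ id_of_eq (tens1o X);
  tensmo1 : forall (X Y : mcat) (f : hom X Y),
    id_of_eq (tenso1 Y) ∘ tensm f (id unit) = f ∘ id_of_eq (tenso1 X)
}.

Arguments unit {m}.
Arguments tens {m} X Y : rename.
Arguments tensm {m X Y X' Y'} f g : rename.

Notation "'𝟏'" := unit.
Notation "X ⊗ Y" := (tens X Y) (at level 35, right associativity).
Notation "f ⊗₁ g" := (tensm f g) (at level 35, right associativity).

Section StructuralIdentities.
Context {C : monoidal_category}.

Definition assoc (X Y Z : C) : hom ((X ⊗ Y) ⊗ Z) (X ⊗ (Y ⊗ Z)) :=
  id_of_eq (tensA X Y Z).
Definition assoc_inv (X Y Z : C) : hom (X ⊗ (Y ⊗ Z)) ((X ⊗ Y) ⊗ Z) :=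
  id_of_eq (eq_sym (tensA X Y Z)).
Definition lunit (X : C) : hom (𝟏 ⊗ X) X := id_of_eq (tens1o X).
Definition lunit_inv (X : C) : hom X (𝟏 ⊗ X) := id_of_eq (eq_sym (tens1o X)).
Definition runit (X : C) : hom (X ⊗ 𝟏) X := id_of_eq (tenso1 X).
Definition runit_inv (X : C) : hom X (X ⊗ 𝟏) := id_of_eq (eq_sym (tenso1 X)).

End StructuralIdentities.

(** * Autonomous categories *)

Record autonomous_category := AutonomousCategory {
  acat :> monoidal_category;
  ldual : acat -> acat;
  ev : forall X : acat, hom (ldual X ⊗ X) 𝟏;
  coev : forall X : acat, hom 𝟏 (X ⊗ ldual X);
  ldual_zigzag : forall X : acat,
    runit X ∘ (id X ⊗₁ ev X) ∘ assoc X (ldual X) X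
      ∘ (coev X ⊗₁ id X) ∘ lunit_inv X = id X;
  ldual_zagzig : forall X : acat,
    lunit (ldual X) ∘ (ev X ⊗₁ id (ldual X)) ∘ assoc_inv (ldual X) X (ldual X)
      ∘ (id (ldual X) ⊗₁ coev X) ∘ runit_inv (ldual X) = id (ldual X);
  rdual : acat -> acat;
  evr : forall X : acat, hom (X ⊗ rdual X) 𝟏;
  coevr : forall X : acat, hom 𝟏 (rdual X ⊗ X);
  rdual_zigzag : forall X : acat,
    lunit X ∘ (evr X ⊗₁ id X) ∘ assoc_inv X (rdual X) X
      ∘ (id X ⊗₁ coevr X) ∘ runit_inv X = id X;
  rdual_zagzig : forall X : acat,
    runit (rdual X) ∘ (id (rdual X) ⊗₁ evr X) ∘ assoc (rdual X) X (rdual X)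
      ∘ (coevr X ⊗₁ id (rdual X)) ∘ lunit_inv (rdual X) = id (rdual X)
}.

Arguments ldual {a} X : rename.
Arguments ev {a} X : rename.
Arguments coev {a} X : rename.
Arguments rdual {a} X : rename.
Arguments evr {a} X : rename.
Arguments coevr {a} X : rename.

Definition ldualm (C : autonomous_category) (X Y : C) (f : hom X Y) :
    hom (ldual Y) (ldual X) :=
  lunit (ldual X) ∘ (ev Y ⊗₁ id (ldual X)) ∘ assoc_inv (ldual Y) Y (ldual X)
    ∘ (id (ldual Y) ⊗₁ (f ⊗₁ id (ldual X)))
    ∘ (id (ldual Y) ⊗₁ coev X) ∘ runit_inv (ldual Y).

Definition rdualm (C : autonomous_category) (X Y : C) (f : hom X Y) :
    hom (rdual Y) (rdual X) :=
  runit (rdual X) ∘ (id (rdual X) ⊗₁ evr Y) ∘ assoc (rdual X) Y (rdual Y)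
    ∘ ((id (rdual X) ⊗₁ f) ⊗₁ id (rdual Y))
    ∘ (coevr X ⊗₁ id (rdual Y)) ∘ lunit_inv (rdual Y).

(** * Comonoidal functors and natural transformations *)

Record comonoidal (C D : monoidal_category) (F : functor C D) := Comonoidal {
  com2 : forall X Y : C, hom (F (X ⊗ Y)) (F X ⊗ F Y);
  com0 : hom (F 𝟏) 𝟏;
  com2_nat : forall (X Y X' Y' : C) (f : hom X X') (g : hom Y Y'),
    com2 X' Y' ∘ fmap F (f ⊗₁ g) = (fmap F f ⊗₁ fmap F g) ∘ com2 X Y;
  com_coassoc : forall X Y Z : C,
    assoc (F X) (F Y) (F Z) ∘ (com2 X Y ⊗₁ id (F Z)) ∘ com2 (X ⊗ Y) Z =
    (id (F X) ⊗₁ com2 Y Z) ∘ com2 X (Y ⊗ Z) ∘ fmap F (assoc X Y Z);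
  com_counitl : forall X : C,
    lunit (F X) ∘ (com0 ⊗₁ id (F X)) ∘ com2 𝟏 X = fmap F (lunit X);
  com_counitr : forall X : C,
    runit (F X) ∘ (id (F X) ⊗₁ com0) ∘ com2 X 𝟏 = fmap F (runit X)
}.

Definition com3 (C D : monoidal_category) (F : functor C D) (cF : comonoidal F)
    (X Y Z : C) : hom (F (X ⊗ (Y ⊗ Z))) (F X ⊗ (F Y ⊗ F Z)) :=
  (id (F X) ⊗₁ com2 cF Y Z) ∘ com2 cF X (Y ⊗ Z).

Definition id_comonoidal (C : monoidal_category) : comonoidal (id_functor C).
Proof.
refine (@Comonoidal C C (id_functor C)
          (fun X Y => id (X ⊗ Y)) (id 𝟏) _ _ _ _); intros; simpl.
- rewrite comp_idl, comp_idr; reflexivity.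
- rewrite !tensm_id, !comp_idr, !comp_idl; reflexivity.
- rewrite tensm_id, !comp_idr; reflexivity.
- rewrite tensm_id, !comp_idr; reflexivity.
Defined.

Lemma tensm_idl_comp (C : monoidal_category) (W X Y Z : C)
    (g : hom Y Z) (f : hom X Y) :
  id W ⊗₁ (g ∘ f) = (id W ⊗₁ g) ∘ (id W ⊗₁ f).
Proof. rewrite <- tensm_comp, comp_idl; reflexivity. Qed.

Lemma tensm_idr_comp (C : monoidal_category) (W X Y Z : C)
    (g : hom Y Z) (f : hom X Y) :
  (g ∘ f) ⊗₁ id W = (g ⊗₁ id W) ∘ (f ⊗₁ id W).
Proof. rewrite <- tensm_comp, comp_idl; reflexivity. Qed.

Definition comp_comonoidal (C D E : monoidal_category)
    (G : functor D E) (F : functor C D)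
    (cG : comonoidal G) (cF : comonoidal F) : comonoidal (comp_functor G F).
Proof.
refine (@Comonoidal C E (comp_functor G F)
  (fun X Y => com2 cG (F X) (F Y) ∘ fmap G (com2 cF X Y))
  (com0 cG ∘ fmap G (com0 cF)) _ _ _ _); intros; simpl.
- rewrite <- comp_assoc, <- fmap_comp, com2_nat, fmap_comp, comp_assoc, com2_nat.
  rewrite comp_assoc; reflexivity.
- rewrite tensm_idr_comp, tensm_idl_comp, !comp_assoc.
  rewrite <- (comp_assoc _ (fmap G (com2 cF X Y) ⊗₁ _) (com2 cG _ _)).
  rewrite <- (fmap_id G (F Z)), <- com2_nat.
  rewrite !comp_assoc, (fmap_id G (F Z)), com_coassoc.
  rewrite <- (comp_assoc _ (id _ ⊗₁ fmap G (com2 cF Y Z)) (com2 cG _ _)).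
  rewrite <- (fmap_id G (F X)), <- com2_nat.
  rewrite <- !comp_assoc, <- !fmap_comp, !comp_assoc, com_coassoc.
  reflexivity.
- rewrite tensm_idr_comp, !comp_assoc.
  rewrite <- (comp_assoc _ (fmap G (com0 cF) ⊗₁ _) (com2 cG _ _)).
  rewrite <- (fmap_id G (F X)), <- com2_nat.
  rewrite !comp_assoc, (fmap_id G (F X)), com_counitl.
  rewrite <- !fmap_comp, com_counitl; reflexivity.
- rewrite tensm_idl_comp, !comp_assoc.
  rewrite <- (comp_assoc _ (_ ⊗₁ fmap G (com0 cF)) (com2 cG _ _)).
  rewrite <- (fmap_id G (F X)), <- com2_nat.
  rewrite !comp_assoc, (fmap_id G (F X)), com_counitr.
  rewrite <- !fmap_comp, com_counitr; reflexivity.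
Defined.

Definition is_comonoidal_trans (C D : monoidal_category) (F G : functor C D)
    (cF : comonoidal F) (cG : comonoidal G) (phi : nat_trans F G) : Prop :=
  (forall X Y : C,
     com2 cG X Y ∘ phi (X ⊗ Y) = (phi X ⊗₁ phi Y) ∘ com2 cF X Y) /\
  com0 cG ∘ phi 𝟏 = com0 cF.

(** * Monads, bimonads, Hopf monads *)

Record monad (C : category) (T : functor C C) := Monad {
  mu : nat_trans (comp_functor T T) T;
  eta : nat_trans (id_functor C) T;
  mu_assoc : forall X : C, mu X ∘ fmap T (mu X) = mu X ∘ mu (T X);
  mu_etal : forall X : C, mu X ∘ eta (T X) = id (T X);
  mu_etar : forall X : C, mu X ∘ fmap T (eta X) = id (T X)
}.

Record bimonad (C : monoidal_category) (T : functor C C) := Bimonad {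
  bimonad_monad :> monad T;
  bimonad_comonoidal :> comonoidal T;
  mu_comonoidal :
    is_comonoidal_trans (comp_comonoidal bimonad_comonoidal bimonad_comonoidal)
      bimonad_comonoidal (mu bimonad_monad);
  eta_comonoidal :
    is_comonoidal_trans (id_comonoidal C) bimonad_comonoidal (eta bimonad_monad)
}.

Record left_antipode (C : autonomous_category) (T : functor C C)
    (B : bimonad T) := LeftAntipode {
  santl :> forall X : C, hom (T (ldual (T X))) (ldual X);
  santl_nat : forall (X Y : C) (f : hom X Y),
    santl X ∘ fmap T (ldualm (fmap T f)) = ldualm f ∘ santl Y;
  santl_ev : forall X : C,
    com0 B ∘ fmap T (ev X) ∘ fmap T (ldualm (eta B X) ⊗₁ id X) =
    ev (T X) ∘ ((santl (T X) ∘ fmap T (ldualm (mu B X))) ⊗₁ id (T X))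
      ∘ com2 B (ldual (T X)) X;
  santl_coev : forall X : C,
    (eta B X ⊗₁ id (ldual X)) ∘ coev X ∘ com0 B =
    (mu B X ⊗₁ santl X) ∘ com2 B (T X) (ldual (T X)) ∘ fmap T (coev (T X))
}.

Record right_antipode (C : autonomous_category) (T : functor C C)
    (B : bimonad T) := RightAntipode {
  santr :> forall X : C, hom (T (rdual (T X))) (rdual X);
  santr_nat : forall (X Y : C) (f : hom X Y),
    santr X ∘ fmap T (rdualm (fmap T f)) = rdualm f ∘ santr Y;
  santr_ev : forall X : C,
    com0 B ∘ fmap T (evr X) ∘ fmap T (id X ⊗₁ rdualm (eta B X)) =
    evr (T X) ∘ (id (T X) ⊗₁ (santr (T X) ∘ fmap T (rdualm (mu B X))))
      ∘ com2 B X (rdual (T X));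
  santr_coev : forall X : C,
    (id (rdual X) ⊗₁ eta B X) ∘ coevr X ∘ com0 B =
    (santr X ⊗₁ mu B X) ∘ com2 B (rdual (T X)) (T X) ∘ fmap T (coevr (T X))
}.

Record hopf_monad (C : autonomous_category) (T : functor C C) := HopfMonad {
  hopf_bimonad :> bimonad T;
  sl : left_antipode hopf_bimonad;
  sr : right_antipode hopf_bimonad
}.

(** * Centralizers *)

Record centralizer (C : monoidal_category) (T Z : functor C C) := Centralizer {
  cpart :> forall X Y : C, hom (X ⊗ Y) (T Y ⊗ Z X);
  cpart_nat : forall (X X' Y Y' : C) (f : hom X X') (g : hom Y Y'),
    cpart X' Y' ∘ (f ⊗₁ g) = (fmap T g ⊗₁ fmap Z f) ∘ cpart X Y;
  cpart_univ : forall (X W : C) (xi : forall Y : C, hom (X ⊗ Y) (T Y ⊗ W)),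
    (forall (Y Y' : C) (g : hom Y Y'),
       xi Y' ∘ (id X ⊗₁ g) = (fmap T g ⊗₁ id W) ∘ xi Y) ->
    exists! r : hom (Z X) W, forall Y : C, xi Y = (id (T Y) ⊗₁ r) ∘ cpart X Y
}.

Definition coend_map (C : autonomous_category) (T Z : functor C C)
    (d : centralizer T Z) (X Y : C) : hom (ldual (T Y) ⊗ (X ⊗ Y)) (Z X) :=
  lunit (Z X) ∘ (ev (T Y) ⊗₁ id (Z X)) ∘ assoc_inv (ldual (T Y)) (T Y) (Z X)
    ∘ (id (ldual (T Y)) ⊗₁ d X Y).

(* These equations determine the product, unit and comonoidal structure of
   [P], by the universal property of [d]. *)
Record is_centralizer_structure (C : monoidal_category) (T Z : functor C C)
    (B : bimonad T) (d : centralizer T Z) (P : bimonad Z) : Prop := {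
  centralizer_mu : forall X Y1 Y2 : C,
    (id (T Y1 ⊗ T Y2) ⊗₁ mu P X) ∘ assoc_inv (T Y1) (T Y2) (Z (Z X))
      ∘ (id (T Y1) ⊗₁ d (Z X) Y2) ∘ assoc (T Y1) (Z X) Y2
      ∘ (d X Y1 ⊗₁ id Y2) =
    (com2 B Y1 Y2 ⊗₁ id (Z X)) ∘ d X (Y1 ⊗ Y2) ∘ assoc X Y1 Y2;
  centralizer_eta : forall X : C,
    eta P X = lunit (Z X) ∘ (com0 B ⊗₁ id (Z X)) ∘ d X 𝟏 ∘ runit_inv X;
  centralizer_com2 : forall X1 X2 Y : C,
    (id (T Y) ⊗₁ com2 P X1 X2) ∘ d (X1 ⊗ X2) Y =
    (mu B Y ⊗₁ id (Z X1 ⊗ Z X2)) ∘ assoc (T (T Y)) (Z X1) (Z X2)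
      ∘ (d X1 (T Y) ⊗₁ id (Z X2)) ∘ assoc_inv X1 (T Y) (Z X2)
      ∘ (id X1 ⊗₁ d X2 Y) ∘ assoc X1 X2 Y;
  centralizer_com0 : forall Y : C,
    runit (T Y) ∘ (id (T Y) ⊗₁ com0 P) ∘ d 𝟏 Y ∘ lunit_inv Y = eta B Y
}.

(** * Distributive laws *)

(* Distributive law of [MT] over [MP]. *)
Record is_distributive_law (C : category) (T P : functor C C)
    (MT : monad T) (MP : monad P)
    (Omega : nat_trans (comp_functor T P) (comp_functor P T)) : Prop := {
  distr_prod : forall X : C,
    Omega X ∘ fmap T (mu MP X) = mu MP (T X) ∘ fmap P (Omega X) ∘ Omega (P X);
  distr_unit : forall X : C, Omega X ∘ fmap T (eta MP X) = eta MP (T X);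
  distr_mu : forall X : C,
    Omega X ∘ mu MT (P X) = fmap P (mu MT X) ∘ Omega (T X) ∘ fmap T (Omega X);
  distr_eta : forall X : C, Omega X ∘ eta MT (P X) = fmap P (eta MT X)
}.

Definition is_comonoidal_distributive_law (C : monoidal_category)
    (T P : functor C C) (BT : bimonad T) (BP : bimonad P)
    (Omega : nat_trans (comp_functor T P) (comp_functor P T)) : Prop :=
  is_distributive_law BT BP Omega /\
  is_comonoidal_trans (comp_comonoidal BT BP) (comp_comonoidal BP BT) Omega.

Definition omega_equation (C : autonomous_category) (T Z : functor C C)
    (H : hopf_monad T) (d : centralizer T Z)
    (X : C) (w : hom (T (Z X)) (Z (T X))) : Prop :=
  forall Y : C,
    w ∘ fmap T (coend_map d X Y) =
    coend_map d (T X) (T Y)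
      ∘ ((ldualm (mu H Y) ∘ sl H (T Y) ∘ fmap T (ldualm (mu H Y)))
           ⊗₁ id (T X ⊗ T Y))
      ∘ com3 H (ldual (T Y)) X Y.

(* Main.v *)
Require Import Defs.
From Stdlib Require Import Eqdep IndefiniteDescription.
Set Implicit Arguments.
Unset Strict Implicit.
Unset Printing Implicit Defensive.

(* Since the antipodes make the dual of [T Y] a [T]-module, the equation defining
   [Omega] is transposed, across the duality between [ldual (T Y)] and [T Y], into
     (id ⊗ Omega_X) H_Y T(d_{X,Y}) = (mu_Y ⊗ id) d_{TX,TY} T_2(X,Y)
   where H_Y = (mu_Y ⊗ id) T_2(T Y, -) is the fusion operator. A Hopf monad has a
   right adjoint, so H_Y T(d_{X,Y}) is again universal; this gives existence and
   uniqueness of [Omega], and each axiom of a comonoidal distributive law follows by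
   comparing two morphisms after composition with a universal family. The inverse
   of [Omega] comes from the universality of [d] and the inverse of the fusion
   operator (id ⊗ mu_Y) T_2(X, T Y).

   The objects of a strict monoidal category are associative only up to an equality
   of objects. To avoid transports, duality and [d] are used in a form natural in an
   additional right-hand factor [W] (suffix W), with all tensor products nested to
   the right. *)

Notation "X ◁ f" := (tensm (id X) f) (at level 35, right associativity).
Notation "f ▷ X" := (tensm f (id X)) (at level 35, right associativity).

(** * Rewriting inside composites nested to the right *)

Section Rewriting.
Context {C : category}.

Lemma comp_eq2 (X Y Z : C) (g : hom Y Z) (f : hom X Y) h :
  g ∘ f = h -> forall W (k : hom W X), g ∘ (f ∘ k) = h ∘ k.
Proof. intros E W k; rewrite comp_assoc, E; reflexivity. Qed.

Lemma comp_eq3 (W X Y Z : C) (h : hom Y Z) (g : hom X Y) (f : hom W X) r :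
  h ∘ (g ∘ f) = r -> forall V (k : hom V W), h ∘ (g ∘ (f ∘ k)) = r ∘ k.
Proof. intros E V k; rewrite <- E, !comp_assoc; reflexivity. Qed.

Lemma comp_eq4 (V W X Y Z : C) (i : hom Y Z) (h : hom X Y) (g : hom W X)
    (f : hom V W) r :
  i ∘ (h ∘ (g ∘ f)) = r ->
  forall U (k : hom U V), i ∘ (h ∘ (g ∘ (f ∘ k))) = r ∘ k.
Proof. intros E U k; rewrite <- E, !comp_assoc; reflexivity. Qed.

Lemma comp_congr (X Y Z : C) (g g' : hom Y Z) (f f' : hom X Y) :
  g = g' -> f = f' -> g ∘ f = g' ∘ f'.
Proof. intros -> ->; reflexivity. Qed.

End Rewriting.

Ltac rassoc := rewrite <- ?comp_assoc.

Ltac inst E k :=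
  lazymatch type of E with
  | forall x : ?A, _ => let E' := open_constr:(E _) in inst E' k
  | _ => k E
  end.

(* Rewriting modulo associativity of [∘], all composites being kept nested to
   the right. *)
Ltac crw_eq E :=
  lazymatch type of E with
  | _ ∘ (_ ∘ (_ ∘ _)) = _ => first [rewrite E | rewrite (comp_eq4 E)]
  | _ ∘ (_ ∘ _) = _ => first [rewrite E | rewrite (comp_eq3 E)]
  | _ ∘ _ = _ => first [rewrite E | rewrite (comp_eq2 E)]
  | _ => rewrite E
  end; rassoc.
Tactic Notation "crw" open_constr(E) := rassoc; inst E ltac:(fun e => crw_eq e).
Tactic Notation "crw" "<-" open_constr(E) :=
  rassoc; inst E ltac:(fun e => let e' := open_constr:(eq_sym e) in crw_eq e').

(** * Structural identities and their coherence *)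

Section Casts.
Context {C : category}.

(** Objects form an arbitrary type, so this rests on the axiom of uniqueness of identity proofs. It
    is the whole coherence theorem here: parallel structural identities agree. *)
Lemma id_of_eq_irr (X Y : C) (e e' : X = Y) : id_of_eq e = id_of_eq e'.
Proof. rewrite (UIP _ _ _ e e'); reflexivity. Qed.

Lemma id_of_eq_loop (X : C) (e : X = X) : id_of_eq e = id X.
Proof. exact (id_of_eq_irr e eq_refl). Qed.

Lemma id_of_eq_trans (X Y Z : C) (e : X = Y) (e' : Y = Z) :
  id_of_eq e' ∘ id_of_eq e = id_of_eq (eq_trans e e').
Proof. destruct e'; apply comp_idl. Qed.

Lemma fmap_id_of_eq (D : category) (F : functor C D) (X Y : C) (e : X = Y) :
  fmap F (id_of_eq e) = id_of_eq (f_equal F e).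
Proof. destruct e; apply fmap_id. Qed.

End Casts.

Section MonoidalCasts.
Context {C : monoidal_category}.

Lemma whiskl_id_of_eq (W X Y : C) (e : X = Y) :
  W ◁ id_of_eq e = id_of_eq (f_equal (tens W) e).
Proof. destruct e; apply tensm_id. Qed.

Lemma whiskr_id_of_eq (W X Y : C) (e : X = Y) :
  id_of_eq e ▷ W = id_of_eq (f_equal (fun X => X ⊗ W) e).
Proof. destruct e; apply tensm_id. Qed.

Lemma whiskl_comp (W X Y Z : C) (g : hom Y Z) (f : hom X Y) :
  W ◁ (g ∘ f) = (W ◁ g) ∘ (W ◁ f).
Proof. apply tensm_idl_comp. Qed.

Lemma whiskr_comp (W X Y Z : C) (g : hom Y Z) (f : hom X Y) :
  (g ∘ f) ▷ W = (g ▷ W) ∘ (f ▷ W).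
Proof. apply tensm_idr_comp. Qed.

Lemma tensm_lr (X X' Y Y' : C) (f : hom X X') (g : hom Y Y') :
  f ⊗₁ g = (X' ◁ g) ∘ (f ▷ Y).
Proof. rewrite <- tensm_comp, comp_idl, comp_idr; reflexivity. Qed.

Lemma interchange (X X' Y Y' : C) (f : hom X X') (g : hom Y Y') :
  (f ▷ Y') ∘ (X ◁ g) = (X' ◁ g) ∘ (f ▷ Y).
Proof. rewrite <- !tensm_comp, !comp_idl, !comp_idr; reflexivity. Qed.

Lemma whiskl_sq (W X Y Y' Z' : C) (g : hom Y Z') (f : hom X Y) (g' : hom Y' Z')
    (f' : hom X Y') :
  g ∘ f = g' ∘ f' -> (W ◁ g) ∘ (W ◁ f) = (W ◁ g') ∘ (W ◁ f').
Proof. intro E; rewrite <- !whiskl_comp, E; reflexivity. Qed.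

Lemma whiskr_sq (W X Y Y' Z' : C) (g : hom Y Z') (f : hom X Y) (g' : hom Y' Z')
    (f' : hom X Y') :
  g ∘ f = g' ∘ f' -> (g ▷ W) ∘ (f ▷ W) = (g' ▷ W) ∘ (f' ▷ W).
Proof. intro E; rewrite <- !whiskr_comp, E; reflexivity. Qed.

End MonoidalCasts.

(** Functors and whiskerings are absorbed into structural identities and neighbouring ones are
    fused; afterwards two sides with the same non-structural factors differ only in proofs of
    equality. *)
Ltac merge_casts :=
  unfold assoc, assoc_inv, lunit, lunit_inv, runit, runit_inv;
  rassoc;
  repeat first
    [ rewrite fmap_id_of_eq | rewrite whiskl_id_of_eq | rewrite whiskr_id_of_eq
    | rewrite id_of_eq_trans
    | rewrite (comp_eq2 (id_of_eq_trans _ _)) ];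
  rewrite ?id_of_eq_loop, ?comp_idl, ?comp_idr.
Ltac coherence :=
  merge_casts;
  repeat first [reflexivity | apply id_of_eq_irr | apply comp_congr].

(** * Naturality of the structural identities; iterated whiskering *)

Section AssociatorConjugation.
Context {C : monoidal_category}.

Lemma assoc_nat (X Y Z X' Y' Z' : C) (f : hom X X') (g : hom Y Y')
    (h : hom Z Z') :
  assoc X' Y' Z' ∘ ((f ⊗₁ g) ⊗₁ h) = (f ⊗₁ (g ⊗₁ h)) ∘ assoc X Y Z.
Proof. apply tensmA. Qed.

Lemma assoc_invK (X Y Z : C) : assoc_inv X Y Z ∘ assoc X Y Z = id _.
Proof. coherence. Qed.

Lemma assocK (X Y Z : C) : assoc X Y Z ∘ assoc_inv X Y Z = id _.
Proof. coherence. Qed.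

Lemma assoc_inv_nat (X Y Z X' Y' Z' : C) (f : hom X X') (g : hom Y Y')
    (h : hom Z Z') :
  assoc_inv X' Y' Z' ∘ (f ⊗₁ (g ⊗₁ h)) = ((f ⊗₁ g) ⊗₁ h) ∘ assoc_inv X Y Z.
Proof.
rewrite <- (comp_idr (f ⊗₁ (g ⊗₁ h))), <- assocK.
crw <- assoc_nat. crw assoc_invK. apply comp_idl.
Qed.

Lemma lunit_nat (X Y : C) (f : hom X Y) : lunit Y ∘ (𝟏 ◁ f) = f ∘ lunit X.
Proof. apply tensm1o. Qed.

Lemma runit_nat (X Y : C) (f : hom X Y) : runit Y ∘ (f ▷ 𝟏) = f ∘ runit X.
Proof. apply tensmo1. Qed.

Lemma lunit_inv_nat (X Y : C) (f : hom X Y) :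
  lunit_inv Y ∘ f = (𝟏 ◁ f) ∘ lunit_inv X.
Proof.
transitivity (lunit_inv Y ∘ (f ∘ (lunit X ∘ lunit_inv X))).
- merge_casts; reflexivity.
- crw <- lunit_nat. rewrite comp_assoc.
  replace (lunit_inv Y ∘ lunit Y) with (id (𝟏 ⊗ Y)) by coherence.
  apply comp_idl.
Qed.

Lemma runit_inv_nat (X Y : C) (f : hom X Y) :
  runit_inv Y ∘ f = (f ▷ 𝟏) ∘ runit_inv X.
Proof.
transitivity (runit_inv Y ∘ (f ∘ (runit X ∘ runit_inv X))).
- merge_casts; reflexivity.
- crw <- runit_nat. rewrite comp_assoc.
  replace (runit_inv Y ∘ runit Y) with (id (Y ⊗ 𝟏)) by coherence.
  apply comp_idl.
Qed.

Lemma whiskr_whiskr (X Y V W : C) (f : hom X Y) :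
  (f ▷ V) ▷ W = assoc_inv Y V W ∘ ((f ▷ (V ⊗ W)) ∘ assoc X V W).
Proof.
rewrite <- tensm_id. crw assoc_inv_nat. crw assoc_invK. rewrite comp_idr; reflexivity.
Qed.

Lemma whiskr_whiskl (U X Y W : C) (f : hom X Y) :
  (U ◁ f) ▷ W = assoc_inv U Y W ∘ ((U ◁ (f ▷ W)) ∘ assoc U X W).
Proof.
crw assoc_inv_nat. crw assoc_invK. rewrite comp_idr; reflexivity.
Qed.

Lemma whiskl_whiskl (U V X Y : C) (f : hom X Y) :
  (U ⊗ V) ◁ f = assoc_inv U V Y ∘ ((U ◁ (V ◁ f)) ∘ assoc U V X).
Proof.
rewrite <- tensm_id. crw assoc_inv_nat. crw assoc_invK. rewrite comp_idr; reflexivity.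
Qed.

End AssociatorConjugation.

(** * Dual pairs *)

(** Detached from the chosen duals, so that left duals, right duals and duals in the reversed
    category fall under the same lemmas. *)
Record dual_pair (C : monoidal_category) (A B : C) := DualPair {
  pev : hom (A ⊗ B) 𝟏;
  pcoev : hom 𝟏 (B ⊗ A);
  pzig : runit B ∘ (B ◁ pev) ∘ assoc B A B ∘ (pcoev ▷ B) ∘ lunit_inv B = id B;
  pzag : lunit A ∘ (pev ▷ A) ∘ assoc_inv A B A ∘ (A ◁ pcoev) ∘ runit_inv A = id A
}.

Definition ldual_pair (C : autonomous_category) (X : C) : dual_pair (ldual X) X :=
  DualPair (ldual_zigzag X) (ldual_zagzig X).
Definition rdual_pair (C : autonomous_category) (X : C) : dual_pair X (rdual X) :=
  DualPair (rdual_zagzig X) (rdual_zigzag X).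

Section DualPairs.
Context {C : monoidal_category} {A B : C} (p : dual_pair A B).

Definition evW (W : C) : hom (A ⊗ (B ⊗ W)) W :=
  lunit W ∘ (pev p ▷ W) ∘ assoc_inv A B W.
Definition coevW (W : C) : hom W (B ⊗ (A ⊗ W)) :=
  assoc B A W ∘ (pcoev p ▷ W) ∘ lunit_inv W.

Lemma evW_nat (V W : C) (f : hom V W) :
  evW W ∘ (A ◁ (B ◁ f)) = f ∘ evW V.
Proof.
unfold evW. crw assoc_inv_nat. rewrite tensm_id. crw interchange.
crw lunit_nat. reflexivity.
Qed.

Lemma coevW_nat (V W : C) (f : hom V W) :
  coevW W ∘ f = (B ◁ (A ◁ f)) ∘ coevW V.
Proof.
unfold coevW. crw lunit_inv_nat. crw interchange. rewrite <- tensm_id. crw assoc_nat.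
reflexivity.
Qed.

(** This is the zigzag identity of the pair whiskered by [W], up to coherence. *)
Lemma zigW (W : C) : (B ◁ evW W) ∘ coevW (B ⊗ W) = id (B ⊗ W).
Proof.
unfold evW, coevW. rewrite !whiskl_comp.
transitivity ((runit B ∘ (B ◁ pev p) ∘ assoc B A B ∘ (pcoev p ▷ B) ∘ lunit_inv B) ▷ W).
- rewrite !whiskr_comp, whiskr_whiskr, whiskr_whiskl. coherence.
- rewrite pzig. apply tensm_id.
Qed.

Lemma zagW (W : C) : evW (A ⊗ W) ∘ (A ◁ coevW W) = id (A ⊗ W).
Proof.
unfold evW, coevW. rewrite !whiskl_comp.
transitivity ((lunit A ∘ (pev p ▷ A) ∘ assoc_inv A B A ∘ (A ◁ pcoev p) ∘ runit_inv A) ▷ W).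
- rewrite !whiskr_comp, whiskr_whiskr, whiskr_whiskl. coherence.
- rewrite pzag. apply tensm_id.
Qed.
End DualPairs.

(** * Transposition across a dual pair, and nondegeneracy of its pairing *)

Section Transposition.
Context {C : monoidal_category} {A B : C} (p : dual_pair A B).

Lemma transpose_inj (X W : C) (f g : hom X (B ⊗ W)) :
  evW p W ∘ (A ◁ f) = evW p W ∘ (A ◁ g) -> f = g.
Proof.
intro E.
rewrite <- (comp_idl f), <- (comp_idl g), <- (zigW p W).
crw (coevW_nat p f). crw (coevW_nat p g).
rewrite !comp_assoc, <- !whiskl_comp, E.
reflexivity.
Qed.

Lemma transposeK (X W : C) (f : hom X (B ⊗ W)) :
  (B ◁ (evW p W ∘ (A ◁ f))) ∘ coevW p X = f.
Proof. rewrite whiskl_comp. crw <- coevW_nat. crw zigW. apply comp_idl. Qed.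

Lemma transposeVK (X W : C) (f : hom (A ⊗ X) W) :
  evW p W ∘ (A ◁ ((B ◁ f) ∘ coevW p X)) = f.
Proof. rewrite whiskl_comp. crw evW_nat. crw zagW. apply comp_idr. Qed.

(** The case of a trivial extra factor, through which pairings inherit injectivity and surjectivity
    from transposition. *)
Lemma pev_evW : pev p = evW p 𝟏 ∘ (A ◁ runit_inv B).
Proof.
unfold evW. transitivity (runit 𝟏 ∘ ((pev p ▷ 𝟏) ∘ runit_inv (A ⊗ B))).
- crw <- runit_inv_nat. merge_casts; reflexivity.
- coherence.
Qed.

Lemma pairing_evW (X : C) (f : hom X B) :
  pev p ∘ (A ◁ f) = evW p 𝟏 ∘ (A ◁ (runit_inv B ∘ f)).
Proof. rewrite pev_evW, whiskl_comp, <- comp_assoc; reflexivity. Qed.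

Lemma pairing_inj_r (X : C) (f g : hom X B) :
  pev p ∘ (A ◁ f) = pev p ∘ (A ◁ g) -> f = g.
Proof.
rewrite !pairing_evW; intros E%transpose_inj.
rewrite <- (comp_idl f), <- (comp_idl g).
replace (id B) with (runit B ∘ runit_inv B) by coherence.
crw E; reflexivity.
Qed.

Lemma pairing_surj_r (X : C) (c : hom (A ⊗ X) 𝟏) :
  exists f : hom X B, c = pev p ∘ (A ◁ f).
Proof.
exists (runit B ∘ ((B ◁ c) ∘ coevW p X)).
rewrite pairing_evW, comp_assoc.
replace (runit_inv B ∘ runit B) with (id (B ⊗ 𝟏)) by coherence.
rewrite comp_idl, transposeVK; reflexivity.
Qed.
End Transposition.

(** * Variants of coassociativity and counitality of a comonoidal functor *)

Lemma com_coassocr (C : monoidal_category) (T : functor C C) (cT : comonoidal T)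
    (X Y Z : C) :
  assoc (T X) (T Y) (T Z) ∘ ((com2 cT X Y ▷ T Z) ∘ com2 cT (X ⊗ Y) Z) =
  (T X ◁ com2 cT Y Z) ∘ (com2 cT X (Y ⊗ Z) ∘ fmap T (assoc X Y Z)).
Proof. rewrite !comp_assoc; apply com_coassoc. Qed.

Lemma com_counitlr (C : monoidal_category) (T : functor C C) (cT : comonoidal T)
    (X : C) :
  lunit (T X) ∘ ((com0 cT ▷ T X) ∘ com2 cT 𝟏 X) = fmap T (lunit X).
Proof. rewrite comp_assoc; apply com_counitl. Qed.

Lemma com_counitl_inv (C : monoidal_category) (T : functor C C)
    (cT : comonoidal T) (X : C) :
  (com0 cT ▷ T X) ∘ (com2 cT 𝟏 X ∘ fmap T (lunit_inv X)) = lunit_inv (T X).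
Proof.
rewrite <- (comp_idl (com0 cT ▷ T X)).
replace (id (𝟏 ⊗ T X)) with (lunit_inv (T X) ∘ lunit (T X)) by coherence.
crw com_counitlr. coherence.
Qed.

Lemma com_counitr_inv (C : monoidal_category) (T : functor C C)
    (cT : comonoidal T) (X : C) :
  (T X ◁ com0 cT) ∘ (com2 cT X 𝟏 ∘ fmap T (runit_inv X)) = runit_inv (T X).
Proof.
rewrite <- (comp_idl (T X ◁ com0 cT)).
replace (id (T X ⊗ 𝟏)) with (runit_inv (T X) ∘ runit (T X)) by coherence.
rassoc. rewrite (comp_assoc (_ ◁ _)), (comp_assoc (runit _)).
rewrite (comp_assoc (runit (T X))), com_counitr. coherence.
Qed.

Lemma com_coassoc_inv (C : monoidal_category) (T : functor C C) (cT : comonoidal T)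
    (X Y Z : C) :
  assoc_inv (T X) (T Y) (T Z) ∘ ((T X ◁ com2 cT Y Z) ∘ com2 cT X (Y ⊗ Z)) =
  (com2 cT X Y ▷ T Z) ∘ (com2 cT (X ⊗ Y) Z ∘ fmap T (assoc_inv X Y Z)).
Proof.
rewrite <- (comp_idl (com2 cT X Y ▷ T Z)), <- assoc_invK. crw com_coassocr.
rewrite <- fmap_comp, assocK, fmap_id, comp_idr; reflexivity.
Qed.

(* The monoidal category with the opposite tensor product: it exchanges the two
   members of a dual pair, hence left and right fusion operators. *)
Definition rev (C : monoidal_category) : monoidal_category.
Proof.
refine (@MonoidalCategory C unit (fun X Y => Y ⊗ X)
  (fun X Y X' Y' f g => g ⊗₁ f) _ _
  (fun X Y Z => eq_sym (tensA Z Y X)) (@tenso1 C) (@tens1o C) _ _ _).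
- intros X Y; exact (tensm_id Y X).
- intros X Y X' Y' X'' Y'' f' f g' g; exact (tensm_comp g' g f' f).
- intros X Y Z X' Y' Z' f g h; exact (assoc_inv_nat h g f).
- intros X Y f; exact (tensmo1 f).
- intros X Y f; exact (tensm1o f).
Defined.

Definition rev_comonoidal (C : monoidal_category) (T : functor C C)
    (cT : comonoidal T) : @comonoidal (rev C) (rev C) T.
Proof.
refine (@Comonoidal (rev C) (rev C) T (fun X Y => com2 cT Y X) (com0 cT) _ _ _ _).
- intros X Y X' Y' f g; exact (com2_nat cT g f).
- intros X Y Z. generalize (com_coassoc_inv cT Z Y X). rewrite !comp_assoc. exact (fun E => E).
- exact (com_counitr cT).
- exact (com_counitl cT).
Defined.

Definition rev_pair (C : monoidal_category) (A B : C) (p : dual_pair A B) :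
  @dual_pair (rev C) B A.
Proof.
refine (@DualPair (rev C) B A (pev p) (pcoev p) _ _).
- exact (pzag p).
- refine (eq_trans _ (pzig p)).
  (* The inverse associator of the reversed category involves a double [eq_sym], identified with
     [assoc] only by coherence. *)
  change (runit B ∘ (B ◁ pev p) ∘ id_of_eq (eq_sym (eq_sym (tensA B A B)))
    ∘ (pcoev p ▷ B) ∘ lunit_inv B
   = runit B ∘ (B ◁ pev p) ∘ assoc B A B ∘ (pcoev p ▷ B) ∘ lunit_inv B).
  coherence.
Defined.

(** * Fusion operators *)

Section LinearPairs.
Context {C : monoidal_category} {T : functor C C} (cT : comonoidal T).

(** When [a] and [b] are module structures, evaluation and coevaluation are thus morphisms of
    [T]-modules. *)
Record linear_pair (A B : C) (p : dual_pair A B) (a : hom (T A) A)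
    (b : hom (T B) B) : Prop := LinearPair {
  linear_ev : pev p ∘ ((a ⊗₁ b) ∘ com2 cT A B) = com0 cT ∘ fmap T (pev p);
  linear_coev : (b ⊗₁ a) ∘ (com2 cT B A ∘ fmap T (pcoev p)) = pcoev p ∘ com0 cT
}.

(** The map [a] is left general in order to cover both [T Y] and its duals. *)
Definition fusion (A : C) (a : hom (T A) A) (W : C) : hom (T (A ⊗ W)) (A ⊗ T W) :=
  (a ▷ T W) ∘ com2 cT A W.

Lemma com2_natr (X Y Y' : C) (g : hom Y Y') :
  com2 cT X Y' ∘ fmap T (X ◁ g) = (T X ◁ fmap T g) ∘ com2 cT X Y.
Proof. rewrite com2_nat, fmap_id; reflexivity. Qed.

Lemma com2_natl (X X' Y : C) (f : hom X X') :
  com2 cT X' Y ∘ fmap T (f ▷ Y) = (fmap T f ▷ T Y) ∘ com2 cT X Y.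
Proof. rewrite com2_nat, fmap_id; reflexivity. Qed.

Lemma fusion_nat (A : C) (a : hom (T A) A) (V W : C) (f : hom V W) :
  fusion a W ∘ fmap T (A ◁ f) = (A ◁ fmap T f) ∘ fusion a V.
Proof. unfold fusion. crw com2_natr. crw interchange. reflexivity. Qed.

Context {A B : C} {p : dual_pair A B} {a : hom (T A) A} {b : hom (T B) B}
  (L : linear_pair p a b).

(** Coassociativity merges the two fusions, linearity of evaluation replaces the actions by [com0],
    and the counit law removes it. *)
Lemma fusion_evW (W : C) :
  evW p (T W) ∘ ((A ◁ fusion b W) ∘ fusion a (B ⊗ W)) = fmap T (evW p W).
Proof.
unfold fusion, evW. rewrite whiskl_comp. crw <- interchange.
crw assoc_inv_nat. rewrite <- (tensm_id (T B) (T W)). crw assoc_inv_nat.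
crw com_coassoc_inv.
transitivity (lunit (T W) ∘ (((pev p ∘ ((a ⊗₁ b) ∘ com2 cT A B)) ▷ T W)
  ∘ (com2 cT (A ⊗ B) W ∘ fmap T (assoc_inv A B W)))).
{ rewrite !whiskr_comp, (tensm_lr a b), whiskr_comp. rassoc; reflexivity. }
rewrite (linear_ev L), whiskr_comp. crw <- com2_natl. crw com_counitlr.
rewrite !fmap_comp; rassoc; reflexivity.
Qed.

Lemma fusion_coevW (W : C) :
  (B ◁ fusion a W) ∘ (fusion b (A ⊗ W) ∘ fmap T (coevW p W)) = coevW p (T W).
Proof.
unfold fusion, coevW. rewrite whiskl_comp, !fmap_comp. crw <- interchange.
crw <- com_coassocr.
rewrite <- (tensm_id (T A) (T W)). crw <- assoc_nat. crw <- assoc_nat.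
crw com2_natl.
transitivity (assoc B A (T W) ∘ (((b ⊗₁ a) ∘ (com2 cT B A ∘ fmap T (pcoev p))) ▷ T W
  ∘ (com2 cT 𝟏 W ∘ fmap T (lunit_inv W)))).
{ rewrite !whiskr_comp, (tensm_lr b a), whiskr_comp. rassoc; reflexivity. }
rewrite (linear_coev L), whiskr_comp. crw com_counitl_inv. reflexivity.
Qed.

(** The transpose of the fusion operator of the dual [B]. Linearity of evaluation makes it a left
    inverse, linearity of coevaluation a right inverse. *)
Definition fusion_inv (W : C) : hom (A ⊗ T W) (T (A ⊗ W)) :=
  evW p (T (A ⊗ W)) ∘ (A ◁ (fusion b (A ⊗ W) ∘ fmap T (coevW p W))).

Lemma fusionK (W : C) : fusion_inv W ∘ fusion a W = id (T (A ⊗ W)).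
Proof.
unfold fusion_inv. rewrite whiskl_comp. crw <- fusion_nat. crw fusion_evW.
rewrite <- fmap_comp, zagW. apply fmap_id.
Qed.

Lemma fusion_invK (W : C) : fusion a W ∘ fusion_inv W = id (A ⊗ T W).
Proof.
unfold fusion_inv. crw <- evW_nat. rewrite <- !whiskl_comp.
rewrite fusion_coevW. apply zagW.
Qed.

End LinearPairs.

Lemma pairing_inj_l (C : monoidal_category) (A B : C) (p : dual_pair A B)
    (X : C) (f g : hom X A) :
  pev p ∘ (f ▷ B) = pev p ∘ (g ▷ B) -> f = g.
Proof. exact (@pairing_inj_r (rev C) B A (rev_pair p) X f g). Qed.

Lemma pairing_surj_l (C : monoidal_category) (A B : C) (p : dual_pair A B)
    (X : C) (c : hom (X ⊗ B) 𝟏) :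
  exists f : hom X A, c = pev p ∘ (f ▷ B).
Proof. exact (@pairing_surj_r (rev C) B A (rev_pair p) X c). Qed.

(** * Mates and antipodes *)

Section Mates.
Context {C : monoidal_category} {A B A' B' : C}
  (p : dual_pair A B) (p' : dual_pair A' B').

(** A relational form of [g] being dual to [f], valid for any choice of dual pairs. *)
Definition mates (g : hom A' A) (f : hom B B') : Prop :=
  pev p ∘ (g ▷ B) = pev p' ∘ (A' ◁ f).

Definition dual_mor (f : hom B B') : hom A' A :=
  evW p' A ∘ ((A' ◁ ((f ▷ A) ∘ pcoev p)) ∘ runit_inv A').

Lemma mate_evW (g : hom A' A) (f : hom B B') (W : C) :
  mates g f ->
  evW p W ∘ (g ▷ (B ⊗ W)) = evW p' W ∘ (A' ◁ (f ▷ W)).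
Proof.
intro E. unfold evW. rewrite <- (tensm_id B W). crw assoc_inv_nat. crw assoc_inv_nat.
rewrite (comp_eq2 (eq_sym (whiskr_comp _ _ _))).
rewrite (comp_eq2 (eq_sym (whiskr_comp _ _ _))).
rewrite E; reflexivity.
Qed.

Lemma zag_pcoev (A0 B0 : C) (q : dual_pair A0 B0) :
  evW q A0 ∘ (A0 ◁ pcoev q) = runit A0.
Proof.
rewrite <- (comp_idl (runit A0)).
refine (eq_trans _ (f_equal (fun k => k ∘ runit A0) (pzag q))).
unfold evW. coherence.
Qed.

(** Transposing across [p'] reduces the claim about coevaluations to the defining one about
    evaluations. *)
Lemma mate_coev (g : hom A' A) (f : hom B B') :
  mates g f -> (f ▷ A) ∘ pcoev p = (B' ◁ g) ∘ pcoev p'.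
Proof.
intro E; apply (transpose_inj (p := p')). rewrite !whiskl_comp.
crw <- (mate_evW A E). crw evW_nat. rewrite zag_pcoev.
crw interchange. crw zag_pcoev. apply runit_nat.
Qed.

(** Nondegeneracy of [p] provides some mate [g] of [f], and the explicit formula evaluates to this
    [g]. *)
Lemma dual_mor_mates (f : hom B B') : mates (dual_mor f) f.
Proof.
destruct (pairing_surj_l p (pev p' ∘ (A' ◁ f))) as [g E]. symmetry in E.
replace (dual_mor f) with g; [exact E|].
unfold dual_mor. rewrite (mate_coev E), whiskl_comp.
crw evW_nat. crw zag_pcoev. transitivity (g ∘ id A').
- symmetry; apply comp_idr.
- f_equal. coherence.
Qed.

End Mates.

(** * The chosen dual morphisms as mates *)

Section DualMorphisms.
Context {C : autonomous_category}.

Lemma ldualm_mates (X Y : C) (f : hom X Y) :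
  mates (ldual_pair X) (ldual_pair Y) (ldualm f) f.
Proof.
replace (ldualm f) with (dual_mor (ldual_pair X) (ldual_pair Y) f).
- apply dual_mor_mates.
- unfold dual_mor, evW, ldualm; rewrite whiskl_comp, !comp_assoc; reflexivity.
Qed.

Lemma rdualm_mates (X Y : C) (f : hom X Y) :
  @mates (rev C) _ _ _ _ (rev_pair (rdual_pair X)) (rev_pair (rdual_pair Y))
    (rdualm f) f.
Proof.
replace (rdualm f)
  with (@dual_mor (rev C) _ _ _ _ (rev_pair (rdual_pair X))
          (rev_pair (rdual_pair Y)) f).
- apply dual_mor_mates.
- unfold dual_mor, evW, rdualm.
  change (runit (rdual X) ∘ (rdual X ◁ evr Y)
      ∘ id_of_eq (eq_sym (eq_sym (tensA (rdual X) Y (rdual Y))))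
      ∘ ((((rdual X ◁ f) ∘ coevr X) ▷ rdual Y) ∘ lunit_inv (rdual Y))
    = runit (rdual X) ∘ (rdual X ◁ evr Y) ∘ assoc (rdual X) Y (rdual Y)
      ∘ ((rdual X ◁ f) ▷ rdual Y) ∘ (coevr X ▷ rdual Y) ∘ lunit_inv (rdual Y)).
  rewrite whiskr_comp. coherence.
Qed.
End DualMorphisms.

(** * Monad laws in reduced form *)

Section Monads.
Context {C : category} {T : functor C C} (M : monad T).

(* The type of [mu M X] mentions [comp_functor T T X], which blocks rewriting;
   here it is reduced to [T (T X)]. *)
Definition mult (X : C) : hom (T (T X)) (T X) := mu M X.
Definition unit_of (X : C) : hom X (T X) := eta M X.

Lemma unit_nat (X Y : C) (f : hom X Y) : unit_of Y ∘ f = fmap T f ∘ unit_of X.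
Proof. exact (naturality (eta M) f). Qed.

Lemma mult_nat (X Y : C) (f : hom X Y) :
  mult Y ∘ fmap T (fmap T f) = fmap T f ∘ mult X.
Proof. exact (naturality (mu M) f). Qed.

Lemma mult_assoc (X : C) : mult X ∘ fmap T (mult X) = mult X ∘ mult (T X).
Proof. exact (mu_assoc M X). Qed.

Lemma mult_unitl (X : C) : mult X ∘ unit_of (T X) = id (T X).
Proof. exact (mu_etal M X). Qed.

Lemma mult_unitr (X : C) : mult X ∘ fmap T (unit_of X) = id (T X).
Proof. exact (mu_etar M X). Qed.

End Monads.

(** * The action defined by an antipode on the dual of a free module *)

Section AntipodeLinearity.
Context {C : monoidal_category} {T : functor C C} (M : monad T)
  (cT : comonoidal T) (D : C -> C) (p : forall X, dual_pair (D X) X)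
  (Dm : forall {X Y : C}, hom X Y -> hom (D Y) (D X))
  (Dm_mates : forall X Y (f : hom X Y), mates (p X) (p Y) (Dm f) f)
  (s : forall X, hom (T (D (T X))) (D X))
  (s_nat : forall X Y (f : hom X Y),
     s X ∘ fmap T (Dm (fmap T f)) = Dm f ∘ s Y)
  (s_ev : forall X,
     com0 cT ∘ fmap T (pev (p X)) ∘ fmap T (Dm (unit_of M X) ▷ X) =
     pev (p (T X)) ∘ ((s (T X) ∘ fmap T (Dm (mult M X))) ▷ T X)
       ∘ com2 cT (D (T X)) X)
  (s_coev : forall X,
     (unit_of M X ▷ D X) ∘ pcoev (p X) ∘ com0 cT =
     (mult M X ⊗₁ s X) ∘ com2 cT (T X) (D (T X)) ∘ fmap T (pcoev (p (T X)))).

Lemma Dm_pev (X Y : C) (f : hom X Y) :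
  pev (p X) ∘ (Dm f ▷ X) = pev (p Y) ∘ (D Y ◁ f).
Proof using Dm_mates. apply Dm_mates. Qed.

Lemma Dm_comp (X Y Z : C) (g : hom Y Z) (f : hom X Y) :
  Dm (g ∘ f) = Dm f ∘ Dm g.
Proof using Dm_mates.
apply (pairing_inj_l (p := p X)). rewrite Dm_pev, whiskr_comp, whiskl_comp.
crw Dm_pev. crw <- interchange. crw Dm_pev. reflexivity.
Qed.

Lemma Dm_id (X : C) : Dm (id X) = id (D X).
Proof using Dm_mates.
apply (pairing_inj_l (p := p X)). rewrite Dm_pev, !tensm_id; reflexivity.
Qed.

(** Stated for abstract duals [D] and antipode [s], to be used in [C] for left antipodes and in
    [rev C] for right ones. For evaluation, [mult] is moved to the dual side, and naturality of [s]
    with associativity brings in the antipode axiom at [T X]. For coevaluation, [mult] is applied to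
    the antipode axiom and then carried across the coevaluation to its mate. *)
Lemma antipode_linear (X : C) :
  linear_pair cT (p (T X)) (s (T X) ∘ fmap T (Dm (mult M X))) (mult M X).
Proof using Dm_mates s_nat s_ev s_coev.
split.
- rewrite tensm_lr. crw <- Dm_pev.
  rewrite (comp_eq2 (eq_sym (whiskr_comp _ _ _))).
  replace (Dm (mult M X) ∘ (s (T X) ∘ fmap T (Dm (mult M X))))
    with ((s (T (T X)) ∘ fmap T (Dm (mult M (T X)))) ∘ fmap T (Dm (mult M X))).
  2:{ crw <- s_nat. rewrite <- !fmap_comp, <- !Dm_comp, mult_assoc. reflexivity. }
  rewrite whiskr_comp. crw <- com2_natl.
  rewrite !comp_assoc. rewrite <- (s_ev (T X)). rassoc.
  rewrite <- !fmap_comp, <- whiskr_comp, <- Dm_comp, mult_unitl, Dm_id, tensm_id, comp_idr.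
  reflexivity.
- transitivity ((mult M X ▷ D (T X)) ∘ ((unit_of M (T X) ▷ D (T X)) ∘ pcoev (p (T X)) ∘ com0 cT)).
  2:{ rewrite !comp_assoc, <- whiskr_comp, mult_unitl, tensm_id, comp_idl; reflexivity. }
  rewrite s_coev. rassoc. symmetry.
  rewrite (comp_assoc (mult M X ▷ _)), <- tensm_comp, comp_idl, <- mult_assoc.
  rewrite (tensm_lr (_ ∘ _)), whiskr_comp.
  crw <- com2_natl. rewrite <- fmap_comp, (mate_coev (Dm_mates (mult M X))).
  rewrite fmap_comp. crw com2_natr. rewrite (tensm_lr _ (_ ∘ _)), whiskl_comp.
  crw interchange. reflexivity.
Qed.

End AntipodeLinearity.

(** * Fusion operators of a Hopf monad *)

Section Bimonads.
Context {C : monoidal_category} {T : functor C C} (B : bimonad T).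

Lemma mult_com2 (X Y : C) :
  com2 B X Y ∘ mult B (X ⊗ Y) =
  (mult B X ⊗₁ mult B Y) ∘ (com2 B (T X) (T Y) ∘ fmap T (com2 B X Y)).
Proof. exact (proj1 (mu_comonoidal B) X Y). Qed.

Lemma mult_com0 : com0 B ∘ mult B 𝟏 = com0 B ∘ fmap T (com0 B).
Proof. exact (proj2 (mu_comonoidal B)). Qed.

Lemma unit_com2 (X Y : C) :
  com2 B X Y ∘ unit_of B (X ⊗ Y) = unit_of B X ⊗₁ unit_of B Y.
Proof.
rewrite <- (comp_idr (unit_of B X ⊗₁ unit_of B Y)).
exact (proj1 (eta_comonoidal B) X Y).
Qed.

Lemma unit_com0 : com0 B ∘ unit_of B 𝟏 = id 𝟏.
Proof. exact (proj2 (eta_comonoidal B)). Qed.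

Definition fus (Y W : C) : hom (T (T Y ⊗ W)) (T Y ⊗ T W) :=
  fusion B (mult B Y) W.

Lemma fusE (Y W : C) : fus Y W = (mult B Y ▷ T W) ∘ com2 B (T Y) W.
Proof. reflexivity. Qed.

Lemma fus_natr (Y V W : C) (f : hom V W) :
  fus Y W ∘ fmap T (T Y ◁ f) = (T Y ◁ fmap T f) ∘ fus Y V.
Proof. apply fusion_nat. Qed.

Lemma fus_natl (X Y W : C) (f : hom X Y) :
  fus Y W ∘ fmap T (fmap T f ▷ W) = (fmap T f ▷ T W) ∘ fus X W.
Proof.
rewrite !fusE. crw com2_natl. rewrite !comp_assoc, <- !whiskr_comp, mult_nat.
reflexivity.
Qed.

(** With [fus_natr] and [fus_unit], this says that [fus Y] lifts the functor [T Y ⊗ -] to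
    [T]-modules. It holds because [mult] is comonoidal and associative. *)
Lemma fus_mult (Y W : C) :
  fus Y W ∘ mult B (T Y ⊗ W) = (T Y ◁ mult B W) ∘ (fus Y (T W) ∘ fmap T (fus Y W)).
Proof.
rewrite !fusE, fmap_comp. crw mult_com2. crw com2_natl.
rewrite (tensm_lr (mult B (T Y))). rassoc.
rewrite (comp_eq2 (interchange (mult B Y) _)).
crw <- (whiskr_comp (T (T W)) (mult B Y)). rewrite <- mult_assoc, whiskr_comp. rassoc.
reflexivity.
Qed.

Lemma fus_unit (Y W : C) : fus Y W ∘ unit_of B (T Y ⊗ W) = T Y ◁ unit_of B W.
Proof.
rewrite !fusE. crw unit_com2. rewrite <- tensm_comp, mult_unitl, comp_idl.
reflexivity.
Qed.

Lemma fus_mult_whiskr (Y W : C) :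
  fus Y W ∘ fmap T (mult B Y ▷ W) = (mult B Y ▷ T W) ∘ fus (T Y) W.
Proof.
rewrite !fusE. crw com2_natl. rewrite !comp_assoc, <- !whiskr_comp, mult_assoc.
reflexivity.
Qed.
End Bimonads.

(** * Inverses of the fusion operators from the antipodes *)

Section HopfMonads.
Context {C : autonomous_category} {T : functor C C} (H : hopf_monad T).

Definition lact (Y : C) : hom (T (ldual (T Y))) (ldual (T Y)) :=
  sl H (T Y) ∘ fmap T (ldualm (mult H Y)).
Definition ract (Y : C) : hom (T (rdual (T Y))) (rdual (T Y)) :=
  sr H (T Y) ∘ fmap T (rdualm (mult H Y)).

Lemma lact_linear (Y : C) :
  linear_pair H (ldual_pair (T Y)) (lact Y) (mult H Y).
Proof.
exact (@antipode_linear C T H H ldual (@ldual_pair C) (@ldualm C) (@ldualm_mates C)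
  (sl H) (@santl_nat C T H (sl H)) (santl_ev (sl H)) (santl_coev (sl H)) Y).
Qed.

Lemma ract_linear (Y : C) :
  linear_pair H (rdual_pair (T Y)) (mult H Y) (ract Y).
Proof.
destruct (@antipode_linear (rev C) T H (rev_comonoidal H) rdual
  (fun X => rev_pair (rdual_pair X)) (@rdualm C) (@rdualm_mates C)
  (sr H) (@santr_nat C T H (sr H)) (santr_ev (sr H)) (santr_coev (sr H)) Y)
  as [E F].
split; [exact E | exact F].
Qed.

(** [fusion_inv] asks for a dual pair with [T Y] as first member, hence for the right dual and the
    right antipode; [rfus_inv], taken in [rev C], uses the left ones. *)
Definition fus_inv (Y W : C) : hom (T Y ⊗ T W) (T (T Y ⊗ W)) :=
  fusion_inv H (p := rdual_pair (T Y)) (b := ract Y) W.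

Lemma fusK (Y W : C) : fus_inv Y W ∘ fus H Y W = id _.
Proof. apply fusionK, ract_linear. Qed.
Lemma fus_invK (Y W : C) : fus H Y W ∘ fus_inv Y W = id _.
Proof. apply fusion_invK, ract_linear. Qed.

Definition rfus (W Y : C) : hom (T (W ⊗ T Y)) (T W ⊗ T Y) :=
  (T W ◁ mult H Y) ∘ com2 H W (T Y).

Definition rfus_inv (W Y : C) : hom (T W ⊗ T Y) (T (W ⊗ T Y)) :=
  @fusion_inv (rev C) T (rev_comonoidal H) (T Y) (ldual (T Y))
     (rev_pair (ldual_pair (T Y))) (lact Y) W.

Lemma rev_lact_linear (Y : C) :
  @linear_pair (rev C) T (rev_comonoidal H) _ _ (rev_pair (ldual_pair (T Y)))
    (mult H Y) (lact Y).
Proof. destruct (lact_linear Y) as [E F]; split; [exact E | exact F]. Qed.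

Lemma rfusK (W Y : C) : rfus_inv W Y ∘ rfus W Y = id _.
Proof. exact (fusionK (rev_lact_linear Y) W). Qed.
Lemma rfus_invK (W Y : C) : rfus W Y ∘ rfus_inv W Y = id _.
Proof. exact (fusion_invK (rev_lact_linear Y) W). Qed.

End HopfMonads.

(** * Laws of the right fusion operator *)

Section RightFusion.
Context {C : autonomous_category} {T : functor C C} (H : hopf_monad T).

Lemma rfusE (W Y : C) : rfus H W Y = (T W ◁ mult H Y) ∘ com2 H W (T Y).
Proof. reflexivity. Qed.

Lemma rfus_natr (W Y Y' : C) (g : hom Y Y') :
  rfus H W Y' ∘ fmap T (W ◁ fmap T g) = (T W ◁ fmap T g) ∘ rfus H W Y.
Proof.
unfold rfus. crw com2_natr. rewrite !comp_assoc, <- !whiskl_comp, mult_nat.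
reflexivity.
Qed.

Lemma rfus_inv_natr (W Y Y' : C) (g : hom Y Y') :
  rfus_inv H W Y' ∘ (T W ◁ fmap T g) = fmap T (W ◁ fmap T g) ∘ rfus_inv H W Y.
Proof.
rewrite <- (comp_idr (rfus_inv H W Y' ∘ _)), <- (rfus_invK H).
crw <- rfus_natr. crw rfusK. rewrite comp_idl; reflexivity.
Qed.

Lemma rfus_unit (W Y : C) :
  rfus H W Y ∘ unit_of H (W ⊗ T Y) = unit_of H W ▷ T Y.
Proof.
unfold rfus. crw unit_com2. rewrite <- tensm_comp, mult_unitl, comp_idl; reflexivity.
Qed.

Lemma rfus_mult (W Y : C) :
  rfus H W Y ∘ mult H (W ⊗ T Y) =
  (mult H W ⊗₁ mult H Y) ∘ (com2 H (T W) (T Y) ∘ fmap T (rfus H W Y)).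
Proof.
unfold rfus. rewrite fmap_comp. crw mult_com2. crw com2_natr.
rewrite !comp_assoc, <- !tensm_comp, mult_assoc, comp_idl, comp_idr. reflexivity.
Qed.

Lemma rfus_whiskl_unit (W Y : C) :
  rfus H W Y ∘ fmap T (W ◁ unit_of H Y) = com2 H W Y.
Proof.
unfold rfus. crw com2_natr.
rewrite comp_assoc, <- whiskl_comp, mult_unitr, tensm_id, comp_idl; reflexivity.
Qed.

Lemma rfus_whiskl_mult (W Y : C) :
  rfus H W Y ∘ fmap T (W ◁ mult H Y) = (T W ◁ mult H Y) ∘ rfus H W (T Y).
Proof.
unfold rfus. crw com2_natr.
rewrite !comp_assoc, <- !whiskl_comp, mult_assoc; reflexivity.
Qed.

Lemma rfus_inv_whiskl_mult (W Y : C) :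
  rfus_inv H W Y ∘ (T W ◁ mult H Y) = fmap T (W ◁ mult H Y) ∘ rfus_inv H W (T Y).
Proof.
rewrite <- (comp_idr (rfus_inv H W Y ∘ _)), <- (rfus_invK H).
crw <- rfus_whiskl_mult. crw rfusK. rewrite comp_idl; reflexivity.
Qed.

(** * Linear pairings of free modules with values in the unit module *)

Definition linear_pairing (B V : C) (p : hom (T B ⊗ T V) 𝟏) : Prop :=
  p ∘ ((mult H B ⊗₁ mult H V) ∘ com2 H (T B) (T V)) = com0 H ∘ fmap T p.

(* Together with [linear_pairing_extendr], this makes pairings of [B] with [T V]
   correspond to pairings of [T B] with [V]. *)
Lemma linear_pairing_extendl (B V : C) (c : hom (B ⊗ T V) 𝟏) :
  exists! p, linear_pairing p /\ c = p ∘ (unit_of H B ▷ T V).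
Proof.
(* [rfus] is a linear isomorphism from the free module on [B ⊗ T V], so [c] has exactly one linear
   extension. *)
exists (com0 H ∘ (fmap T c ∘ rfus_inv H B V)); split; [split|].
- unfold linear_pairing.
  (* Linearity is tested after the isomorphism [fmap T (rfus H B V)]; taking its inverse for [q]
     removes it again. *)
  enough (E : forall X (q : hom X (T (T (B ⊗ T V)))), com0 H ∘ (fmap T c ∘ rfus_inv H B V) ∘
     ((mult H B ⊗₁ mult H V) ∘ (com2 H (T B) (T V) ∘ (fmap T (rfus H B V) ∘ q)))
     = com0 H ∘ (fmap T (com0 H ∘ (fmap T c ∘ rfus_inv H B V)) ∘ (fmap T (rfus H B V) ∘ q))).
  { specialize (E _ (fmap T (rfus_inv H B V))).
    rewrite <- !fmap_comp, !rfus_invK, fmap_id, !comp_idr in E. exact E. }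
  intros X q. crw <- rfus_mult. crw rfusK. rewrite comp_idl.
  rewrite !fmap_comp. crw <- mult_nat. crw mult_com0.
  crw <- (fmap_comp T (rfus_inv H B V)).
  rewrite rfusK, fmap_id, comp_idl; reflexivity.
- rassoc. rewrite <- rfus_unit. crw rfusK. rewrite comp_idl, <- unit_nat.
  crw unit_com0. rewrite comp_idl; reflexivity.
- intros p [L ->]. rewrite fmap_comp. crw <- L. crw com2_natl.
  rewrite (tensm_lr (mult H B)). crw <- (whiskr_comp (T (T V)) (mult H B)).
  rewrite mult_unitr, tensm_id, comp_idl. crw <- rfusE. crw rfus_invK. apply comp_idr.
Qed.

(** Now the linear isomorphism is [fus], from the free module on [T B ⊗ V]. *)
Lemma linear_pairing_extendr (B V : C) (b : hom (T B ⊗ V) 𝟏) :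
  exists! p, linear_pairing p /\ b = p ∘ (T B ◁ unit_of H V).
Proof.
exists (com0 H ∘ (fmap T b ∘ fus_inv H B V)); split; [split|].
- unfold linear_pairing.
  enough (E : forall X (q : hom X (T (T (T B ⊗ V)))), com0 H ∘ (fmap T b ∘ fus_inv H B V) ∘
     ((mult H B ⊗₁ mult H V) ∘ (com2 H (T B) (T V) ∘ (fmap T (fus H B V) ∘ q)))
     = com0 H ∘ (fmap T (com0 H ∘ (fmap T b ∘ fus_inv H B V)) ∘ (fmap T (fus H B V) ∘ q))).
  { specialize (E _ (fmap T (fus_inv H B V))).
    rewrite <- !fmap_comp, !fus_invK, fmap_id, !comp_idr in E. exact E. }
  intros X q. rewrite tensm_lr. rassoc. crw <- fusE. crw <- fus_mult.
  crw fusK. rewrite comp_idl.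
  rewrite !fmap_comp. crw <- mult_nat. crw mult_com0.
  crw <- (fmap_comp T (fus_inv H B V)).
  rewrite fusK, fmap_id, comp_idl; reflexivity.
- rassoc. rewrite <- fus_unit. crw fusK. rewrite comp_idl, <- unit_nat.
  crw unit_com0. rewrite comp_idl; reflexivity.
- intros p [L ->]. rewrite fmap_comp. crw <- L. crw com2_natr.
  rewrite (tensm_lr (mult H B)). crw interchange.
  crw <- (whiskl_comp _ (mult H V)).
  rewrite mult_unitr, tensm_id, comp_idl. crw <- fusE. crw fus_invK. apply comp_idr.
Qed.

End RightFusion.

(** * The right adjoint of a Hopf monad *)

Definition universal_arrow (C : category) (T : functor C C) (R W : C)
    (e : hom (T R) W) : Prop :=
  forall (B : C) (f : hom (T B) W), exists! g : hom B R, f = e ∘ fmap T g.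

Section UniversalArrows.
Context {C : autonomous_category} {T : functor C C} (H : hopf_monad T).

(* [T] has a right adjoint: pairings transport maps [T B -> W] to maps
   [B -> ldual (T (rdual W))]. *)
Lemma universal_arrow_exists (W : C) :
  exists (R : C) (e : hom (T R) W), universal_arrow e.
Proof.
pose (V := rdual W). exists (ldual (T V)).
(* The linear extension [q] of evaluation, restricted along the unit of [V], is the pairing that
   defines the counit [e]. *)
destruct (linear_pairing_extendl H (ev (T V))) as [q [[Lq Eq] _]].
destruct (pairing_surj_l (rdual_pair W) (q ∘ (T _ ◁ unit_of H V))) as [e Ee].
exists e; intros B f.
(* Each [g] gives a linear pairing whose restrictions along the two units represent [g] and
   [e ∘ fmap T g]. *)
assert (L : forall g : hom B (ldual (T V)),
  linear_pairing H (q ∘ (fmap T g ▷ T V)) /\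
  ev (T V) ∘ (g ▷ T V) = q ∘ ((fmap T g ▷ T V) ∘ (unit_of H B ▷ T V)) /\
  pev (rdual_pair W) ∘ ((e ∘ fmap T g) ▷ V) =
    q ∘ ((fmap T g ▷ T V) ∘ (T B ◁ unit_of H V))).
{ intro g; repeat split.
  - red. rewrite fmap_comp. crw <- Lq. crw com2_natl.
    rewrite (comp_assoc (mult H _ ⊗₁ _)), <- tensm_comp, mult_nat, comp_idr.
    rewrite (comp_assoc (_ ▷ _)), <- tensm_comp, comp_idl. reflexivity.
  - rewrite Eq, <- whiskr_comp, <- unit_nat, whiskr_comp, comp_assoc; reflexivity.
  - rewrite whiskr_comp. crw <- Ee. crw interchange. reflexivity. }
destruct (linear_pairing_extendr H (pev (rdual_pair W) ∘ (f ▷ V)))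
  as [p [[Lp Ep] Up]].
destruct (pairing_surj_l (ldual_pair (T V)) (p ∘ (unit_of H B ▷ T V))) as [g Eg].
change (pev (ldual_pair (T V))) with (ev (T V)) in Eg.
exists g; split.
- destruct (L g) as (Lg & E1 & E2).
  apply (pairing_inj_l (p := rdual_pair W)).
  change (pev (rdual_pair W) ∘ (f ▷ V) =
    pev (rdual_pair W) ∘ ((e ∘ fmap T g) ▷ V)).
  rewrite Ep, E2, comp_assoc.
  (* Both pairings are linear and agree along the unit of [B]. *)
  replace p with (q ∘ (fmap T g ▷ T V)); [reflexivity|].
  destruct (linear_pairing_extendl H (ev (T V) ∘ (g ▷ T V))) as [r [_ Ur]].
  rewrite <- (Ur p (conj Lp (eq_sym Eg))). symmetry; apply Ur; split; [exact Lg|].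
  rewrite E1, comp_assoc; reflexivity.
- intros g' Ef. destruct (L g') as (Lg & E1 & E2).
  apply (pairing_inj_l (p := ldual_pair (T V))).
  change (pev (ldual_pair (T V))) with (ev (T V)).
  rewrite <- Eg, E1, comp_assoc. f_equal. apply Up; split; [exact Lg|].
  rewrite Ef, E2, comp_assoc; reflexivity.
Qed.

(** A map from [T B] to [A ⊗ W] corresponds, by transposition twisted with [fusion H a' B], to a map
    from [T (A' ⊗ B)] to [W]; universality of [e] applies there, and the factor is transposed
    back. *)
Lemma universal_arrow_tens (A R W : C) (a : hom (T A) A) (A' : C)
    (p : dual_pair A' A) (a' : hom (T A') A') (e : hom (T R) W) :
  linear_pair H p a' a -> universal_arrow e ->
  universal_arrow ((A ◁ e) ∘ fusion H a R).
Proof.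
intros L U B f.
destruct (U _ (evW p W ∘ ((A' ◁ f) ∘ fusion H a' B))) as [g [Eg Ug]].
exists ((A ◁ g) ∘ coevW p B); split.
- rewrite fmap_comp. crw fusion_nat. rewrite comp_assoc, <- whiskl_comp, <- Eg.
  rewrite !whiskl_comp. crw (fusion_coevW L). crw <- coevW_nat. crw zigW.
  rewrite comp_idl; reflexivity.
- intros g' Ef. rewrite (Ug (evW p R ∘ (A' ◁ g'))); [apply transposeK|].
  rewrite Ef, fmap_comp, <- (fusion_evW L), !whiskl_comp. crw fusion_nat.
  crw evW_nat. reflexivity.
Qed.

Lemma universal_arrow_inj (R W B : C) (e : hom (T R) W) (f g : hom B R) :
  universal_arrow e -> e ∘ fmap T f = e ∘ fmap T g -> f = g.
Proof.
intros U E. destruct (U _ (e ∘ fmap T f)) as [h [_ Uh]].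
rewrite <- (Uh f eq_refl). apply Uh, E.
Qed.

Lemma universal_arrow_fus (Y R W : C) (e : hom (T R) W) :
  universal_arrow e -> universal_arrow ((T Y ◁ e) ∘ fus H Y R).
Proof. exact (universal_arrow_tens (lact_linear H Y)). Qed.

End UniversalArrows.

(** * Centralizers *)

(** Universal properties give morphisms object by object, in [Prop]; the axiom of indefinite
    description assembles them into a family. *)
Lemma dependent_choice_fun (I : Type) (A : I -> Type) (R : forall i, A i -> Prop) :
  (forall i, exists a, R i a) -> exists f : forall i, A i, forall i, R i (f i).
Proof.
intro E. exists (fun i => proj1_sig (constructive_indefinite_description _ (E i))).
intro i. exact (proj2_sig (constructive_indefinite_description _ (E i))).
Qed.

Section Centralizers.
Context {C : autonomous_category} {T Z : functor C C} (d : centralizer T Z).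

Definition centW (X Y W : C) : hom (X ⊗ (Y ⊗ W)) (T Y ⊗ (Z X ⊗ W)) :=
  assoc (T Y) (Z X) W ∘ ((d X Y ▷ W) ∘ assoc_inv X Y W).

Lemma cent_natl (X X' Y : C) (f : hom X X') :
  d X' Y ∘ (f ▷ Y) = (T Y ◁ fmap Z f) ∘ d X Y.
Proof. rewrite cpart_nat, fmap_id; reflexivity. Qed.

Lemma cent_natr (X Y Y' : C) (g : hom Y Y') :
  d X Y' ∘ (X ◁ g) = (fmap T g ▷ Z X) ∘ d X Y.
Proof. rewrite cpart_nat, fmap_id; reflexivity. Qed.

Lemma centW_nat (X X' Y Y' W W' : C) (f : hom X X') (g : hom Y Y') (h : hom W W') :
  centW X' Y' W' ∘ (f ⊗₁ (g ⊗₁ h)) = (fmap T g ⊗₁ (fmap Z f ⊗₁ h)) ∘ centW X Y W.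
Proof.
unfold centW. crw assoc_inv_nat. crw <- assoc_nat.
rewrite (comp_assoc (d X' Y' ▷ W')), (comp_assoc (_ ⊗₁ h)), <- !tensm_comp.
rewrite cpart_nat, comp_idl, comp_idr; reflexivity.
Qed.

Lemma centW_natm (X Y Y' W : C) (g : hom Y Y') :
  centW X Y' W ∘ (X ◁ (g ▷ W)) = (fmap T g ▷ (Z X ⊗ W)) ∘ centW X Y W.
Proof. rewrite centW_nat, fmap_id, tensm_id; reflexivity. Qed.

Lemma centW_natr (X Y W W' : C) (h : hom W W') :
  centW X Y W' ∘ (X ◁ (Y ◁ h)) = (T Y ◁ (Z X ◁ h)) ∘ centW X Y W.
Proof. rewrite centW_nat, !fmap_id; reflexivity. Qed.

Lemma cent_epic (X W : C) (f g : hom (Z X) W) :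
  (forall Y, (T Y ◁ f) ∘ d X Y = (T Y ◁ g) ∘ d X Y) -> f = g.
Proof.
intro E.
destruct (cpart_univ d (X := X) (W := W) (xi := fun Y => (T Y ◁ f) ∘ d X Y))
  as [r [_ U]].
- intros Y Y' k. crw cent_natr. crw <- interchange. reflexivity.
- rewrite <- (U f (fun Y => eq_refl)). apply U, E.
Qed.

(** Moving [W] to the target as its left dual turns [f] and [g] into maps out of [Z X], to which
    [cent_epic] applies. *)
Lemma centW_epic (X W V : C) (f g : hom (Z X ⊗ W) V) :
  (forall Y, (T Y ◁ f) ∘ centW X Y W = (T Y ◁ g) ∘ centW X Y W) -> f = g.
Proof.
intro E.
pose (p := rev_pair (ldual_pair W)).
pose (tr k := (k ▷ ldual W) ∘ (assoc_inv (Z X) W (ldual W) ∘ (Z X ◁ coev W) ∘ runit_inv (Z X))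
   : hom (Z X) (V ⊗ ldual W)).
(* On the universal family, the transpose of [k] depends on [k] only through its composite with
   [centW]. *)
assert (K : forall k Y, (T Y ◁ tr k) ∘ d X Y =
  assoc (T Y) V (ldual W) ∘ ((((T Y ◁ k) ∘ centW X Y W) ▷ ldual W) ∘
  (assoc X Y W ▷ ldual W ∘ (assoc_inv (X ⊗ Y) W (ldual W) ∘
   (((X ⊗ Y) ◁ coev W) ∘ runit_inv (X ⊗ Y)))))).
{ intros k Y. unfold tr, centW. rewrite !whiskl_comp, !whiskr_comp. rassoc.
  crw assoc_nat. f_equal.
  replace (T Y ◁ assoc_inv (Z X) W (ldual W))
    with (assoc (T Y) (Z X ⊗ W) (ldual W) ∘ ((assoc (T Y) (Z X) W ▷ ldual W) ∘
      (assoc_inv (T Y ⊗ Z X) W (ldual W) ∘ assoc_inv (T Y) (Z X) (W ⊗ ldual W))))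
    by coherence.
  rassoc. do 2 f_equal. crw assoc_inv_nat. rewrite tensm_id.
  rewrite (comp_eq2 (g := assoc_inv X Y W ▷ _) (h := id _)); [rewrite comp_idl |].
  2:{ rewrite <- whiskr_comp, assoc_invK; apply tensm_id. }
  rewrite whiskr_whiskr. crw (assocK (X ⊗ Y)). rewrite comp_idl.
  crw interchange. crw <- runit_inv_nat. coherence. }
assert (tr f = tr g) as Et.
{ apply cent_epic; intro Y. rewrite !K, E; reflexivity. }
refine (eq_trans (eq_sym (@transposeVK (rev C) _ _ p (Z X) V f)) _).
refine (eq_trans _ (@transposeVK (rev C) _ _ p (Z X) V g)).
f_equal. f_equal. exact Et.
Qed.

(** * The universal family transported by [T] *)

Context (H : hopf_monad T).

Definition centT (X Y : C) : hom (T (X ⊗ Y)) (T Y ⊗ T (Z X)) :=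
  fus H Y (Z X) ∘ fmap T (d X Y).

Lemma centTE (X Y : C) : centT X Y = fus H Y (Z X) ∘ fmap T (d X Y).
Proof. reflexivity. Qed.

Lemma centT_natr (X Y Y' : C) (g : hom Y Y') :
  centT X Y' ∘ fmap T (X ◁ g) = (fmap T g ▷ T (Z X)) ∘ centT X Y.
Proof.
unfold centT. rassoc. rewrite <- fmap_comp, cent_natr, fmap_comp. crw fus_natl.
reflexivity.
Qed.

Lemma centT_natl (X X' Y : C) (f : hom X X') :
  centT X' Y ∘ fmap T (f ▷ Y) = (T Y ◁ fmap T (fmap Z f)) ∘ centT X Y.
Proof.
unfold centT. rassoc. rewrite <- fmap_comp, cent_natl, fmap_comp. crw fus_natr.
reflexivity.
Qed.

Lemma centT_unit (X Y : C) :
  centT X Y ∘ unit_of H (X ⊗ Y) = (T Y ◁ unit_of H (Z X)) ∘ d X Y.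
Proof. unfold centT. crw <- unit_nat. crw fus_unit. reflexivity. Qed.

Lemma centT_mult (X Y : C) :
  centT X Y ∘ mult H (X ⊗ Y) =
  (T Y ◁ mult H (Z X)) ∘ (fus H Y (T (Z X)) ∘ fmap T (centT X Y)).
Proof.
unfold centT. crw <- mult_nat. crw fus_mult. rewrite fmap_comp. reflexivity.
Qed.

(* [T] being a left adjoint, it sends the universal family [d X] to the universal
   family [centT X]. *)
Lemma centT_univ (X W : C) (xi : forall Y : C, hom (T (X ⊗ Y)) (T Y ⊗ W)) :
  (forall (Y Y' : C) (g : hom Y Y'),
     xi Y' ∘ fmap T (X ◁ g) = (fmap T g ▷ W) ∘ xi Y) ->
  exists! r : hom (T (Z X)) W, forall Y : C, xi Y = (T Y ◁ r) ∘ centT X Y.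
Proof.
intro N. destruct (universal_arrow_exists H W) as (R & e & U).
(* Every [xi Y] factors through the universal arrow to [T Y ⊗ W]. *)
assert (S : forall Y, exists g : hom (X ⊗ Y) (T Y ⊗ R),
  xi Y = ((T Y ◁ e) ∘ fus H Y R) ∘ fmap T g).
{ intro Y. destruct (universal_arrow_fus H (Y := Y) U (xi Y)) as [g [Eg _]].
  exists g; exact Eg. }
assert (F : forall (r : hom (Z X) R) Y,
  (T Y ◁ (e ∘ fmap T r)) ∘ centT X Y =
  ((T Y ◁ e) ∘ fus H Y R) ∘ fmap T ((T Y ◁ r) ∘ d X Y)).
{ intros r Y. unfold centT. rewrite whiskl_comp, fmap_comp. crw fus_natr. reflexivity. }
(* Uniqueness of factorizations makes the factors natural in [Y], as the universality of [d]
   requires. *)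
assert (N' : forall (xi' : forall Y, hom (X ⊗ Y) (T Y ⊗ R)),
  (forall Y, xi Y = ((T Y ◁ e) ∘ fus H Y R) ∘ fmap T (xi' Y)) ->
  forall Y Y' (g : hom Y Y'), xi' Y' ∘ (X ◁ g) = (fmap T g ▷ R) ∘ xi' Y).
{ intros xi' E Y Y' g. apply (universal_arrow_inj (universal_arrow_fus H (Y := Y') U)).
  rewrite !fmap_comp, (comp_assoc (_ ∘ _) (fmap T (xi' Y'))), <- E, N, E.
  crw fus_natl. crw <- interchange. reflexivity. }
destruct (dependent_choice_fun S) as [xi' E].
destruct (cpart_univ d (N' xi' E)) as [r [Er Ur]].
exists (e ∘ fmap T r); split.
- intro Y. rewrite F, <- Er. apply E.
- intros f Ef. destruct (U _ f) as [r' [-> _]].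
  rewrite (Ur r'); [reflexivity|]. intro Y.
  apply (universal_arrow_inj (universal_arrow_fus H (Y := Y) U)).
  rewrite <- F, <- E. apply Ef.
Qed.

Lemma centT_epic (X W : C) (f g : hom (T (Z X)) W) :
  (forall Y, (T Y ◁ f) ∘ centT X Y = (T Y ◁ g) ∘ centT X Y) -> f = g.
Proof.
intro E.
destruct (centT_univ (X := X) (W := W) (xi := fun Y => (T Y ◁ f) ∘ centT X Y))
  as [r [_ U]].
- intros Y Y' k. crw centT_natr. crw <- interchange. reflexivity.
- rewrite <- (U f (fun Y => eq_refl)). apply U, E.
Qed.

(** Factoring [f] and [g] through a universal arrow strips one [T] and leaves [centT_epic]. *)
Lemma centTT_epic (X W : C) (f g : hom (T (T (Z X))) W) :
  (forall Y, (T Y ◁ f) ∘ (fus H Y (T (Z X)) ∘ fmap T (centT X Y)) =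
     (T Y ◁ g) ∘ (fus H Y (T (Z X)) ∘ fmap T (centT X Y))) -> f = g.
Proof.
intro E. destruct (universal_arrow_exists H W) as (R & e & U).
destruct (U _ f) as [f' [-> _]]. destruct (U _ g) as [g' [-> _]].
do 2 f_equal. apply centT_epic; intro Y.
apply (universal_arrow_inj (universal_arrow_fus H (Y := Y) U)).
rewrite !fmap_comp. crw fus_natr. crw fus_natr.
specialize (E Y). rewrite !whiskl_comp, <- !comp_assoc in E. exact E.
Qed.

(** Once [T] is stripped in the same way, [cent_epic] tests the outer [Z] with [Y2] and [centW_epic]
    the inner one with [Y1]. *)
Lemma centT2_epic (X W : C) (f g : hom (T (Z (Z X))) W) :
  (forall Y1 Y2,
     (T Y1 ◁ ((T Y2 ◁ f) ∘ centT (Z X) Y2)) ∘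
       (fus H Y1 (Z X ⊗ Y2) ∘ fmap T (centW X Y1 Y2)) =
     (T Y1 ◁ ((T Y2 ◁ g) ∘ centT (Z X) Y2)) ∘
       (fus H Y1 (Z X ⊗ Y2) ∘ fmap T (centW X Y1 Y2))) -> f = g.
Proof.
intro E. destruct (universal_arrow_exists H W) as (R & e & U).
destruct (U _ f) as [f' [-> _]]. destruct (U _ g) as [g' [-> _]].
do 2 f_equal. apply cent_epic; intro Y2. apply centW_epic; intro Y1.
pose proof (universal_arrow_fus H (Y := Y2) U) as U2.
apply (universal_arrow_inj (universal_arrow_fus H (Y := Y1) U2)).
rewrite !fmap_comp.
specialize (E Y1 Y2). unfold centT in E.
rewrite !whiskl_comp, !fmap_comp in *. rassoc. repeat crw fus_natr. rewrite <- !comp_assoc in E.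
do 2 crw (whiskl_sq _ (fus_natr H _ _)). exact E.
Qed.

(** The version of the hypothesis with an extra factor: coassociativity isolates the hypothesis
    whiskered by [T W]. *)
Lemma intertwining_centW (X Y W : C) (w : hom (T (Z X)) (Z (T X))) :
  (forall Y, (T Y ◁ w) ∘ centT X Y =
    (mult H Y ▷ Z (T X)) ∘ (d (T X) (T Y) ∘ com2 H X Y)) ->
  (T Y ◁ (w ▷ T W)) ∘ ((T Y ◁ com2 H (Z X) W)
    ∘ (fus H Y (Z X ⊗ W) ∘ fmap T (centW X Y W))) =
  (mult H Y ▷ (Z (T X) ⊗ T W)) ∘ (centW (T X) (T Y) (T W)
    ∘ ((T X ◁ com2 H Y W) ∘ com2 H X (Y ⊗ W))).
Proof.
intro E. unfold centW. rewrite !fmap_comp, fusE.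
crw <- interchange. crw <- com_coassocr. crw com2_natl.
rewrite <- (tensm_id (Z (T X)) (T W)). crw <- assoc_nat.
rewrite <- (tensm_id (T (Z X)) (T W)). crw <- assoc_nat. crw <- assoc_nat.
f_equal.
transitivity ((((T Y ◁ w) ∘ centT X Y) ▷ T W) ∘ (com2 H (X ⊗ Y) W ∘ fmap T (assoc_inv X Y W))).
{ unfold centT. rewrite fusE, !whiskr_comp. rassoc.
  reflexivity. }
rewrite E, !whiskr_comp. crw com_coassoc_inv. reflexivity.
Qed.

(** * Fusion over a tensor product of parameters *)

Definition com2W (X Y W : C) : hom (T (X ⊗ Y) ⊗ W) (T X ⊗ (T Y ⊗ W)) :=
  assoc (T X) (T Y) W ∘ (com2 H X Y ▷ W).

(** Since [mult] is comonoidal, fusion over [Y1 ⊗ Y2] splits into two successive fusions. *)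
Lemma fus_com2W (Y1 Y2 W : C) :
  (T Y1 ◁ fus H Y2 W) ∘ (fus H Y1 (T Y2 ⊗ W) ∘ fmap T (com2W Y1 Y2 W)) =
  com2W Y1 Y2 (T W) ∘ fus H (Y1 ⊗ Y2) W.
Proof.
unfold com2W. rewrite !fusE, fmap_comp, whiskl_comp. rassoc.
rewrite (comp_eq2 (eq_sym (whiskr_comp _ _ _))), mult_com2, !whiskr_comp.
crw <- com2_natl. crw assoc_nat. crw com_coassocr.
rewrite (tensm_lr (mult H Y1) (mult H Y2 ▷ _)). crw <- interchange. reflexivity.
Qed.

Lemma com2W_mult (Y1 Y2 W : C) :
  com2W Y1 Y2 W ∘ (mult H (Y1 ⊗ Y2) ▷ W) =
  (T Y1 ◁ (mult H Y2 ▷ W)) ∘ ((mult H Y1 ▷ (T (T Y2) ⊗ W))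
    ∘ (com2W (T Y1) (T Y2) W ∘ (fmap T (com2 H Y1 Y2) ▷ W))).
Proof.
unfold com2W. rassoc. rewrite <- whiskr_comp, mult_com2, !whiskr_comp.
crw assoc_nat. rewrite (tensm_lr (mult H Y1) (mult H Y2 ▷ _)). rassoc. reflexivity.
Qed.

Lemma com2W_nat (Y1 Y2 W W' : C) (f : hom W W') :
  (T Y1 ◁ (T Y2 ◁ f)) ∘ com2W Y1 Y2 W = com2W Y1 Y2 W' ∘ (T (Y1 ⊗ Y2) ◁ f).
Proof.
unfold com2W. crw interchange. crw <- assoc_nat. rewrite tensm_id. reflexivity.
Qed.
End Centralizers.

(** * The distributive law *)

Section Intertwiners.
Context {C : autonomous_category} {T Z : functor C C} (H : hopf_monad T)
  (d : centralizer T Z).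

Definition cent_act (X Y : C) : hom (T (X ⊗ Y)) (T Y ⊗ Z (T X)) :=
  (mult H Y ▷ Z (T X)) ∘ (d (T X) (T Y) ∘ com2 H X Y).

(** The transposed form of [omega_equation], stated without duals or antipodes. *)
Definition intertwiner (X : C) (w : hom (T (Z X)) (Z (T X))) : Prop :=
  forall Y, (T Y ◁ w) ∘ centT d H X Y = cent_act X Y.

(** This is transposition twisted by the action on the dual; [fusion_coevW] gives the formula [K]
    that recovers a map from its image. *)
Lemma act_transpose_inj (Y B W : C) (f g : hom (T B) (T Y ⊗ W)) :
  evW (ldual_pair (T Y)) W ∘ ((ldual (T Y) ◁ f) ∘ fusion H (lact H Y) B) =
  evW (ldual_pair (T Y)) W ∘ ((ldual (T Y) ◁ g) ∘ fusion H (lact H Y) B) -> f = g.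
Proof.
assert (K : forall h : hom (T B) (T Y ⊗ W), h =
  (T Y ◁ (evW (ldual_pair (T Y)) W ∘ ((ldual (T Y) ◁ h) ∘ fusion H (lact H Y) B)))
    ∘ (fusion H (mult H Y) (ldual (T Y) ⊗ B) ∘ fmap T (coevW (ldual_pair (T Y)) B))).
{ intro h. rewrite !whiskl_comp. crw (fusion_coevW (lact_linear H Y)).
  crw <- (coevW_nat _ h). crw zigW. rewrite comp_idl; reflexivity. }
intro E. rewrite (K f), (K g). f_equal. f_equal. exact E.
Qed.

Lemma omega_intertwiner (X : C) (w : hom (T (Z X)) (Z (T X))) :
  omega_equation H d w <-> intertwiner w.
Proof.
pose (E Y (f : hom (T (X ⊗ Y)) (T Y ⊗ Z (T X))) :=
  evW (ldual_pair (T Y)) _ ∘ ((ldual (T Y) ◁ f) ∘ fusion H (lact H Y) (X ⊗ Y))).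
(* Linearity of evaluation splits [fmap T] of the evaluation into two fusions, one of which belongs
   to [centT]. *)
assert (L : forall Y, w ∘ fmap T (coend_map d X Y) =
  E Y ((T Y ◁ w) ∘ centT d H X Y)).
{ intro Y. unfold E, centT, fus. rewrite !whiskl_comp. crw evW_nat.
  crw <- fusion_nat. crw (fusion_evW (lact_linear H Y)).
  rewrite <- fmap_comp. reflexivity. }
(* The outer dual of [mu] is traded for its mate, the product acting on [T (T Y)]. *)
assert (R : forall Y, coend_map d (T X) (T Y)
      ∘ ((ldualm (mu H Y) ∘ sl H (T Y) ∘ fmap T (ldualm (mu H Y)))
           ⊗₁ id (T X ⊗ T Y))
      ∘ com3 H (ldual (T Y)) X Y = E Y (cent_act X Y)).
{ intro Y. unfold E, cent_act, fusion. rewrite !whiskl_comp.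
  crw <- (mate_evW _ (ldualm_mates (mult H Y))).
  change (evW (ldual_pair (T (T Y))) (Z (T X)) ∘ (ldual (T (T Y)) ◁ d (T X) (T Y))
    ∘ (((ldualm (mult H Y) ∘ lact H Y) ▷ (T X ⊗ T Y))
      ∘ ((T (ldual (T Y)) ◁ com2 H X Y) ∘ com2 H (ldual (T Y)) (X ⊗ Y))) =
    evW (ldual_pair (T (T Y))) (Z (T X))
    ∘ ((ldualm (mult H Y) ▷ (T (T Y) ⊗ Z (T X)))
       ∘ ((ldual (T Y) ◁ d (T X) (T Y))
          ∘ ((ldual (T Y) ◁ com2 H X Y)
             ∘ ((lact H Y ▷ T (X ⊗ Y)) ∘ com2 H (ldual (T Y)) (X ⊗ Y)))))).
  rewrite whiskr_comp. crw (interchange (ldualm _) (d _ _)).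
  crw (interchange (ldualm _) (com2 H X Y)).
  crw (interchange (lact H Y)). crw (interchange (ldualm _) (com2 H X Y)).
  reflexivity. }
split.
- intros HO Y. apply act_transpose_inj.
  change (E Y ((T Y ◁ w) ∘ centT d H X Y) = E Y (cent_act X Y)).
  rewrite <- L, <- R. apply HO.
- intros HI Y. rewrite L, R, HI. reflexivity.
Qed.

Lemma cent_act_nat (X Y Y' : C) (g : hom Y Y') :
  cent_act X Y' ∘ fmap T (X ◁ g) = (fmap T g ▷ Z (T X)) ∘ cent_act X Y.
Proof.
unfold cent_act. crw com2_natr. crw cent_natr.
rewrite !comp_assoc, <- !whiskr_comp, mult_nat. reflexivity.
Qed.

Lemma intertwiner_exists (X : C) :
  exists w : hom (T (Z X)) (Z (T X)), intertwiner w.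
Proof.
destruct (centT_univ d H (@cent_act_nat X)) as [w [E _]].
exists w; intro Y; symmetry; apply E.
Qed.

Lemma intertwiner_inj (X : C) (w w' : hom (T (Z X)) (Z (T X))) :
  intertwiner w -> intertwiner w' -> w = w'.
Proof.
intros E E'. apply (@centT_epic _ _ _ d H); intro Y.
rewrite E, E'; reflexivity.
Qed.

(** * Naturality of intertwiners and compatibility with the monad [T] *)

Context (w : forall X, hom (T (Z X)) (Z (T X))) (wI : forall X, intertwiner (w X)).

Lemma wE (X Y : C) : (T Y ◁ w X) ∘ centT d H X Y =
  (mult H Y ▷ Z (T X)) ∘ (d (T X) (T Y) ∘ com2 H X Y).
Proof using wI. apply wI. Qed.

Lemma intertwiner_nat (X X' : C) (f : hom X X') :
  w X' ∘ fmap T (fmap Z f) = fmap Z (fmap T f) ∘ w X.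
Proof using wI.
apply (@centT_epic _ _ _ d H); intro Y. rewrite !whiskl_comp.
crw <- centT_natl. crw wE. crw wE. crw com2_natl. crw cent_natl. crw <- interchange.
reflexivity.
Qed.

Lemma intertwiner_unit (X : C) : w X ∘ unit_of H (Z X) = fmap Z (unit_of H X).
Proof using wI.
apply (cent_epic (d := d)); intro Y. rewrite whiskl_comp.
crw <- centT_unit. crw wE. crw unit_com2. crw cpart_nat.
rewrite comp_assoc, <- tensm_comp, mult_unitr, comp_idl. reflexivity.
Qed.

Lemma intertwiner_mult (X : C) :
  w X ∘ mult H (Z X) = fmap Z (mult H X) ∘ (w (T X) ∘ fmap T (w X)).
Proof using wI.
apply (@centTT_epic _ _ _ d H); intro Y. rewrite !whiskl_comp.
crw <- centT_mult. crw wE. crw mult_com2. crw cpart_nat.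
(* The equation for [w X] is used under [T]; the one for [w (T X)] follows once fusion has passed
   [mult]. *)
crw <- fus_natr. rewrite <- fmap_comp, wE, !fmap_comp.
crw fus_mult_whiskr. crw <- centTE.
crw <- interchange. crw wE.
rewrite (tensm_lr (fmap T _)). crw (interchange (mult H Y)).
crw <- (whiskr_comp _ (mult H Y)).
rewrite mult_assoc, whiskr_comp. rassoc. reflexivity.
Qed.

(** * Invertibility of intertwiners *)

Definition intertwiner_inv_family (X Y : C) : hom (T X ⊗ Y) (T Y ⊗ T (Z X)) :=
  (mult H Y ▷ T (Z X)) ∘ (centT d H X (T Y)
    ∘ (rfus_inv H X Y ∘ (T X ◁ unit_of H Y))).

(** The unit first sends [Y] to [T Y], where the invertible [rfus] can take the place of [com2];
    [mult] finally removes the additional [T]. Universality of [d] turns this natural family into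
    [v], and each composite with [w X] is tested on the universal family of its source. *)
Lemma intertwiner_invertible (X : C) :
  exists v : hom (Z (T X)) (T (Z X)), v ∘ w X = id _ /\ w X ∘ v = id _.
Proof using wI.
destruct (cpart_univ d (X := T X) (W := T (Z X)) (xi := intertwiner_inv_family X))
  as [v [E _]].
{ intros Y Y' g. unfold intertwiner_inv_family. crw <- whiskl_comp.
  rewrite unit_nat, whiskl_comp.
  crw rfus_inv_natr. crw centT_natr. crw <- (whiskr_comp _ (mult H Y')).
  rewrite mult_nat, whiskr_comp. rassoc. reflexivity. }
unfold intertwiner_inv_family in E.
exists v; split.
- apply (@centT_epic _ _ _ d H); intro Y. rewrite whiskl_comp. crw wE.
  crw <- interchange. crw <- E.
  crw <- (whiskr_comp _ (mult H Y)). rewrite <- mult_assoc, whiskr_comp.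
  crw <- centT_natr. crw <- rfus_inv_whiskl_mult.
  crw <- whiskl_comp. rewrite mult_unitl, tensm_id, comp_idl.
  rewrite <- rfus_whiskl_unit. crw rfusK. rewrite comp_idl, centT_natr.
  crw <- (whiskr_comp _ (mult H Y)). rewrite mult_unitr, !tensm_id. reflexivity.
- apply (cent_epic (d := d)); intro Y. rewrite whiskl_comp. crw <- E.
  crw <- interchange. crw wE.
  crw <- (whiskr_comp _ (mult H Y)). rewrite <- mult_assoc, whiskr_comp.
  crw <- cent_natr. crw <- rfusE. crw rfus_invK. rewrite comp_idl, cent_natr.
  crw <- (whiskr_comp _ (mult H Y)). rewrite mult_unitr, !tensm_id. reflexivity.
Qed.

(** * Compatibility with the bimonad structure of the centralizer *)

Context (P : bimonad Z) (HP : is_centralizer_structure H d P).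

Lemma cent_mult (X Y1 Y2 : C) :
  (T Y1 ◁ (T Y2 ◁ mult P X)) ∘ ((T Y1 ◁ d (Z X) Y2) ∘ centW d X Y1 Y2) =
  com2W H Y1 Y2 (Z X) ∘ d X (Y1 ⊗ Y2).
Proof using HP.
assert (E : ((T Y1 ⊗ T Y2) ◁ mult P X) ∘ assoc_inv (T Y1) (T Y2) (Z (Z X))
    ∘ (T Y1 ◁ d (Z X) Y2) ∘ assoc (T Y1) (Z X) Y2 ∘ (d X Y1 ▷ Y2) =
  (com2 H Y1 Y2 ▷ Z X) ∘ d X (Y1 ⊗ Y2) ∘ assoc X Y1 Y2)
  by exact (centralizer_mu HP X Y1 Y2).
unfold centW, com2W. rewrite <- (comp_idr (d X (Y1 ⊗ Y2))), <- assocK.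
rewrite <- !comp_assoc in E. crw <- E.
rewrite whiskl_whiskl. crw assocK. rewrite comp_idl. crw assocK. rewrite comp_idl.
reflexivity.
Qed.

Lemma cent_unit (X : C) :
  unit_of P X = lunit (Z X) ∘ ((com0 H ▷ Z X) ∘ (d X 𝟏 ∘ runit_inv X)).
Proof using HP. rewrite !comp_assoc. exact (centralizer_eta HP X). Qed.

Lemma cent_com2 (X1 X2 Y : C) :
  (T Y ◁ com2 P X1 X2) ∘ d (X1 ⊗ X2) Y =
  (mult H Y ▷ (Z X1 ⊗ Z X2)) ∘ (centW d X1 (T Y) (Z X2)
    ∘ ((X1 ◁ d X2 Y) ∘ assoc X1 X2 Y)).
Proof using HP.
unfold centW. rewrite !comp_assoc. exact (centralizer_com2 HP X1 X2 Y).
Qed.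

Lemma cent_com0 (Y : C) :
  (T Y ◁ com0 P) ∘ d 𝟏 Y = runit_inv (T Y) ∘ (unit_of H Y ∘ lunit Y).
Proof using HP.
pose proof (centralizer_com0 HP Y) as E. change (eta H Y) with (unit_of H Y) in E.
rewrite <- E. rassoc. merge_casts. reflexivity.
Qed.

Lemma intertwiner_prod (X : C) :
  w X ∘ fmap T (mult P X) = mult P (T X) ∘ (fmap Z (w X) ∘ w (Z X)).
Proof using wI HP.
apply (@centT2_epic _ _ _ d H); intros Y1 Y2.
(* The common value uses [d] once, at the parameter [T Y1 ⊗ T Y2]. The left side reaches it by the
   equation for [w X] at [Y1 ⊗ Y2]. *)
transitivity ((T Y1 ◁ (mult H Y2 ▷ Z (T X))) ∘ ((mult H Y1 ▷ (T (T Y2) ⊗ Z (T X)))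
  ∘ (com2W H (T Y1) (T Y2) (Z (T X)) ∘ (d (T X) (T Y1 ⊗ T Y2)
    ∘ ((T X ◁ com2 H Y1 Y2) ∘ com2 H X (Y1 ⊗ Y2)))))).
- unfold centT. rewrite !whiskl_comp. rassoc.
  crw <- (whiskl_sq _ (fus_natr H _ _)). crw <- fus_natr. crw <- fus_natr.
  rewrite <- !fmap_comp, cent_mult, fmap_comp. crw fus_com2W. crw com2W_nat.
  crw <- centTE. crw wE. crw com2W_mult. crw cent_natr. reflexivity.
(* Here [d] splits in two, matching the equation for [w (Z X)] at [Y2] and the one for [w X] at [Y1]
   with an extra factor. *)
- crw <- (cent_mult (T X)).
  assert (K : (T Y2 ◁ (mult P (T X) ∘ (fmap Z (w X) ∘ w (Z X)))) ∘ centT d H (Z X) Y2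
   = (T Y2 ◁ mult P (T X)) ∘ ((mult H Y2 ▷ Z (Z (T X)))
     ∘ (d (Z (T X)) (T Y2) ∘ ((w X ▷ T Y2) ∘ com2 H (Z X) Y2)))).
  { rewrite !whiskl_comp. crw wE. crw cent_natl. crw <- interchange. reflexivity. }
  rewrite K, !whiskl_comp. crw (@intertwining_centW _ _ _ d H X _ _ _ (wE X)).
  crw (interchange (mult H Y1) (_ ◁ mult P _)).
  crw (interchange (mult H Y1) (d _ _)).
  crw (whiskl_sq _ (interchange (mult H Y2) (mult P (T X)))).
  reflexivity.
Qed.

(** The unit of [Z] is [d] at [𝟏] followed by [com0], so this is the intertwiner equation at [𝟏]
    combined with [mult_com0]. *)
Lemma intertwiner_prod_unit (X : C) : w X ∘ fmap T (unit_of P X) = unit_of P (T X).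
Proof using wI HP.
rewrite !cent_unit, !fmap_comp.
transitivity (lunit (Z (T X)) ∘ ((com0 H ▷ Z (T X)) ∘
  ((T 𝟏 ◁ w X) ∘ (centT d H X 𝟏 ∘ fmap T (runit_inv X))))).
- crw interchange. crw lunit_nat. unfold centT. rewrite fusE.
  crw <- (whiskr_comp _ (com0 H)). rewrite mult_com0, whiskr_comp.
  crw <- com2_natl. crw com_counitlr. reflexivity.
- crw wE. crw <- (whiskr_comp _ (com0 H)). rewrite mult_com0, whiskr_comp.
  crw <- cent_natr.
  rewrite com_counitr_inv. reflexivity.
Qed.

(** On the universal family, one side is the equation at [X1 ⊗ X2]; on the other, [cent_com2] used
    under [T] lets the equations for [w X1] and [w X2] act in succession. *)
Lemma intertwiner_com2 (X1 X2 : C) :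
  com2 P (T X1) (T X2) ∘ (fmap Z (com2 H X1 X2) ∘ w (X1 ⊗ X2)) =
  (w X1 ⊗₁ w X2) ∘ (com2 H (Z X1) (Z X2) ∘ fmap T (com2 P X1 X2)).
Proof using wI HP.
apply (@centT_epic _ _ _ d H); intro Y. rewrite !whiskl_comp.
transitivity ((mult H Y ▷ (Z (T X1) ⊗ Z (T X2))) ∘
  ((mult H (T Y) ▷ (Z (T X1) ⊗ Z (T X2))) ∘ (centW d (T X1) (T (T Y)) (Z (T X2))
   ∘ ((T X1 ◁ d (T X2) (T Y)) ∘ ((T X1 ◁ com2 H X2 Y)
     ∘ (com2 H X1 (X2 ⊗ Y) ∘ fmap T (assoc X1 X2 Y))))))).
- crw wE. crw <- interchange. crw <- cent_natl. crw <- interchange.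
  crw cent_com2. crw com_coassocr. reflexivity.
- unfold centT. crw <- fus_natr. rewrite <- fmap_comp, cent_com2, !fmap_comp.
  crw fus_mult_whiskr. rewrite (tensm_lr (w X1)), whiskl_comp. rassoc.
  do 3 crw <- (interchange (mult H Y) _). crw (@intertwining_centW _ _ _ d H X1 _ _ _ (wE X1)).
  crw com2_natr. crw <- (interchange (mult H (T Y))).
  crw <- centW_natr.
  (* Associativity turns the inner product into [fmap T (mult H Y)], which naturality of [centW]
     moves to the parameter. *)
  assert (A : forall W, (mult H Y ▷ W) ∘ (mult H (T Y) ▷ W) =
    (mult H Y ▷ W) ∘ (fmap T (mult H Y) ▷ W)).
  { intro W. apply whiskr_sq. symmetry; apply mult_assoc. }
  do 2 crw A. do 2 crw <- centW_natm.
  assert (K : (mult H Y ▷ Z (T X2)) ∘ ((T (T Y) ◁ w X2)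
      ∘ (com2 H (T Y) (Z X2) ∘ fmap T (d X2 Y))) =
    (mult H Y ▷ Z (T X2)) ∘ (d (T X2) (T Y) ∘ com2 H X2 Y)).
  { rewrite <- wE. unfold centT. rewrite fusE. crw interchange. reflexivity. }
  assert (K' : (T X1 ◁ (mult H Y ▷ Z (T X2))) ∘ ((T X1 ◁ (T (T Y) ◁ w X2))
      ∘ ((T X1 ◁ com2 H (T Y) (Z X2)) ∘ (T X1 ◁ fmap T (d X2 Y)))) =
    (T X1 ◁ (mult H Y ▷ Z (T X2))) ∘ ((T X1 ◁ d (T X2) (T Y)) ∘ (T X1 ◁ com2 H X2 Y))).
  { rewrite <- !whiskl_comp, K; reflexivity. }
  crw K'. reflexivity.
Qed.

Lemma intertwiner_com0 :
  com0 P ∘ (fmap Z (com0 H) ∘ w 𝟏) = com0 H ∘ fmap T (com0 P).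
Proof using wI HP.
apply (@centT_epic _ _ _ d H); intro Y. rewrite !whiskl_comp.
crw wE. crw <- interchange. crw <- cent_natl. crw <- interchange. crw cent_com0.
unfold centT. crw <- fus_natr. rewrite <- fmap_comp, cent_com0, !fmap_comp.
crw com_counitlr. rewrite fusE. crw <- (interchange (mult H Y)).
crw com_counitr_inv. crw <- runit_inv_nat. crw mult_unitl. crw <- runit_inv_nat.
crw mult_unitr. reflexivity.
Qed.

End Intertwiners.

(** As the formula is meant to define [Omega], existence and uniqueness of a solution form part of
    the claim; the second clause treats any natural solution. *)
Theorem theorem6p1 (C : autonomous_category) (T : functor C C) (H : hopf_monad T)
    (Z : functor C C) (d : centralizer T Z)
    (P : hopf_monad Z) (HP : is_centralizer_structure H d P) :
  (exists Omega : nat_trans (comp_functor T Z) (comp_functor Z T),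
     forall X : C, unique (omega_equation H d (X := X)) (Omega X)) /\
  (forall Omega : nat_trans (comp_functor T Z) (comp_functor Z T),
     (forall X : C, omega_equation H d (Omega X)) ->
     invertible Omega /\ is_comonoidal_distributive_law H P Omega).
Proof.
split.
- destruct (dependent_choice_fun (intertwiner_exists H d)) as [w wI].
  exists (@NatTrans _ _ (comp_functor T Z) (comp_functor Z T) w
    (fun X Y f => intertwiner_nat wI f)).
  intro X; split.
  + apply omega_intertwiner, wI.
  + intros w' E. apply (intertwiner_inj (wI X)). apply omega_intertwiner, E.
- intros Omega HO.
  pose (w X := Omega X : hom (T (Z X)) (Z (T X))).
  assert (wI : forall X, intertwiner H d (w X)).
  { intro X. apply omega_intertwiner, HO. }
  split; [|split; [split|split]].
  + destruct (dependent_choice_fun (intertwiner_invertible wI)) as [v Ev].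
    (* Objectwise inverses of a natural family are natural. *)
    assert (vN : forall X Y (f : hom X Y),
      v Y ∘ fmap Z (fmap T f) = fmap T (fmap Z f) ∘ v X).
    { intros X Y f. rewrite <- (comp_idr (v Y ∘ _)), <- (proj2 (Ev X)).
      crw <- (intertwiner_nat wI f). rewrite (comp_assoc (v Y)), (proj1 (Ev Y)).
      rewrite comp_idl; reflexivity. }
    exists (@NatTrans _ _ (comp_functor Z T) (comp_functor T Z) v vN).
    split; intro X; apply Ev.
  + intro X. exact (eq_trans (intertwiner_prod wI HP X) (comp_assoc _ _ _)).
  + exact (intertwiner_prod_unit wI HP).
  + intro X. exact (eq_trans (intertwiner_mult wI X) (comp_assoc _ _ _)).
  + exact (intertwiner_unit wI).
  + intros X Y.
    exact (eq_trans (eq_sym (comp_assoc _ _ _)) (intertwiner_com2 wI HP X Y)).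
  + exact (eq_trans (eq_sym (comp_assoc _ _ _)) (intertwiner_com0 wI HP)).
Qed.
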